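(* Let $r\geq 3$ and let $c$ be a real constant with $0<c<1$ if $r=3$, and $0<c<1/2$ if $r\geq 4$. Then for $n$ sufficiently large, \[ ex_r(n;\mathcal{L}_{n,cn}^{(r)})=\max\left\{\binom{cn}{r},\ \binom{n}{r}-\binom{n-\frac{cn}{r}}{r}\right\}+o(n^r). \]
   Context: An $r$-graph $H=(V,E)$ is a finite vertex set $V$ with a family $E$ of $r$-element subsets of $V$. A tight path is an $r$-graph whose vertices can be ordered $v_1,\dots,v_m$ so that its edges are exactly $\{v_i,v_{i+1},\dots,v_{i+r-1}\}$ for $i=1,\dots,m-r+1$. A tight linear forest is an $r$-graph each of whose connected components is a tight path or an isolated vertex. $\mathcal{L}_{n,k}^{(r)}$ denotes the family of all tight linear forests on $n$ vertices with $k$ edges. For a family $\mathcal{F}$ of $r$-graphs, an $r$-graph is $\mathcal{F}$-free if it contains no subgraph isomorphic to a member of $\mathcal{F}$, and the Turán number $ex_r(n;\mathcal{F})$ is the maximum number of edges in an $\mathcal{F}$-free $r$-graph on $n$ vertices. Quantities such as $cn$ and $cn/r$ are treated as integers (rounded), which only affects lower-order terms; $o(n^r)$ is as $n\to\infty$ with $r,c$ fixed. *)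

(* Defs.v *)
From mathcomp Require Import all_boot.
From mathcomp Require Import boolp.

Set Implicit Arguments.
Unset Strict Implicit.
Unset Printing Implicit Defensive.

(* A hypergraph with vertex set a finite type [T] is given by its edge set
   [E : {set {set T}}]. *)

Section Hypergraph.
Variable T : finType.
Implicit Types (E : {set {set T}}) (C : {set T}) (s : seq T).

Definition is_rgraph (r : nat) E : bool := [forall e in E, #|e| == r].

(* The windows of [r] consecutive vertices of [s]; the number of starting
   positions, [m - r + 1] for [m = size s], is [0] when [m < r]. *)
Definition tight_path_edges (r : nat) s : {set {set T}} :=
  [set [set x in take r (drop i s)] | i : 'I_((size s).+1 - r)].

Definition is_tight_path (r : nat) C E : bool :=
  [exists s : #|C|.-tuple T,
    [&& uniq s, [set x in s] == C & E == tight_path_edges r s]].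

Definition hadj E : rel T := [rel x y | [exists e in E, (x \in e) && (y \in e)]].

Definition component E (x : T) : {set T} := [set y | connect (hadj E) x y].

Definition edges_in E C : {set {set T}} := [set e in E | e \subset C].

Definition is_isolated_vertex C E : bool := (#|C| == 1) && (E == set0).

Definition is_tight_linear_forest (r : nat) E : bool :=
  is_rgraph r E &&
  [forall x, let C := component E x in
    is_tight_path r C (edges_in E C) || is_isolated_vertex C (edges_in E C)].

End Hypergraph.

(* [H] has a (not necessarily induced) subgraph isomorphic to [F]. *)
Definition contains_copy (T U : finType) (H : {set {set U}}) (F : {set {set T}})
    : bool :=
  [exists f : {ffun T -> U}, injectiveb f && [forall e in F, f @: e \in H]].

Definition hfamily := forall T : finType, {set {set T}} -> Prop.

Definition free_of (U : finType) (Fam : hfamily) (H : {set {set U}}) : Prop :=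
  forall (T : finType) (F : {set {set T}}), Fam T F -> ~~ contains_copy H F.

Definition turan_number (r n : nat) (Fam : hfamily) : nat :=
  \max_(H : {set {set 'I_n}} | is_rgraph r H && `[< free_of Fam H >]) #|H|.

Definition tight_linear_forests (r n k : nat) : hfamily :=
  fun T E => [/\ #|T| = n, is_tight_linear_forest r E & #|E| = k].

(* Main.v *)
(* Lower bound: in a tight linear forest every vertex lies in at most r edges, so neither
   a clique on cn - 1 vertices nor the r-graph of all edges meeting a fixed set of
   cn/r - 1 vertices contains a tight linear forest with cn edges.

   Upper bound: a complete r-partite r-graph with parts of size t (a tile) is nearly
   spanned by a tight path, so it suffices to cover more than cn vertices of a dense
   r-graph by disjoint tiles.  Start from a tiling with huge tiles, cut the vertex set
   into clusters refining the tiles, and consider the reduced r-graph of the dense r-tuples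
   of clusters.  A fractional matching of it of weight > cn/r, scaled by a small constant,
   tells how many small tiles to extract greedily from each dense r-tuple (Erdos' theorem
   on complete r-partite subgraphs); few vertices of each cluster are used, so that the old
   tiles survive up to shrinking.  Each round increases the covered proportion by a
   constant as long as it is at most c, hence boundedly many rounds suffice.

   The fractional matching comes from linear programming duality: otherwise there are
   vertex weights of total < cn/r such that every edge of the reduced r-graph has weight
   >= 1, and one has to bound the number of r-tuples of weight >= 1.  If c < 1/2 this is a
   fractional form of Frankl's argument for the Erdos matching conjecture, comparing
   tuples without any of the k heaviest vertices with tuples having exactly one.
   If r = 3, complementary slackness splits the vertices of positive weight into
   (fractional) triples of weight 1, and the count reduces to an inequality about three
   such triples. *)

Require Import Defs.
From HB Require Import structures.
From mathcomp Require Import all_boot all_order all_algebra.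
From mathcomp Require Import ring lra zify.
From mathcomp Require boolp.

Set Implicit Arguments.
Unset Strict Implicit.
Unset Printing Implicit Defensive.

Import Order.TTheory GRing.Theory Num.Theory.


(** * Complete r-partite subgraphs of dense r-graphs *)

Section InsertCoordinate.
Local Open Scope ring_scope.
Variables (T : finType) (r : nat).
Implicit Types (i : 'I_r.+1) (x : T) (f : {ffun 'I_r -> T}).

Definition finsert i x f : {ffun 'I_r.+1 -> T} :=
  [ffun j => if unlift i j is Some j' then f j' else x].

Lemma finsert_at i x f : finsert i x f i = x.
Proof. by rewrite ffunE unlift_none. Qed.

Lemma finsert_lift i x f j : finsert i x f (lift i j) = f j.
Proof. by rewrite ffunE liftK. Qed.

Lemma big_finsert (A : Type) (idx : A) (op : Monoid.com_law idx) i
    (F : {ffun 'I_r.+1 -> T} -> A) :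
  \big[op/idx]_phi F phi =
    \big[op/idx]_x \big[op/idx]_(f : {ffun 'I_r -> T}) F (finsert i x f).
Proof.
rewrite pair_bigA /= (reindex (fun p => finsert i p.1 p.2)) //=.
exists (fun phi : {ffun 'I_r.+1 -> T} =>
          (phi i, [ffun j => phi (lift i j)])) => [[x f]|phi] _ /=.
  rewrite finsert_at; congr pair; apply/ffunP=> j.
  by rewrite ffunE finsert_lift.
apply/ffunP=> j; rewrite ffunE.
by case: unliftP => [j' ->|->] //; rewrite ffunE.
Qed.

Lemma forall_finsert (P : pred T) i x f :
  [forall j, P (finsert i x f j)] = P x && [forall j, P (f j)].
Proof.
apply/forallP/andP=> [H|[Px /forallP Pf] j].
  split; first by have := H i; rewrite finsert_at.
  by apply/forallP=> j; have := H (lift i j); rewrite finsert_lift.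
by rewrite ffunE; case: unlift.
Qed.

Lemma sum_finsert (V : zmodType) (w : T -> V) i x f :
  \sum_j w (finsert i x f j) = w x + \sum_j w (f j).
Proof.
rewrite (bigD1_ord i) //= finsert_at; congr (_ + _).
by apply: eq_bigr => j _; rewrite finsert_lift.
Qed.

Lemma card_coord_in i (L : {pred T}) :
  #|[set phi : {ffun 'I_r.+1 -> T} | phi i \in L]| = (#|L| * #|T| ^ r)%N.
Proof.
rewrite -sum1dep_card big_mkcond (big_finsert _ i) /=.
rewrite -sum_nat_const [RHS]big_mkcond /=; apply: eq_bigr => x _.
under eq_bigr => f _ do rewrite finsert_at.
case: (x \in L); last by rewrite sum_nat_const muln0.
by rewrite sum_nat_const muln1 card_ffun card_ord.
Qed.

End InsertCoordinate.

Lemma ffact_ge n m : ((n - m) ^ m <= n ^_ m)%N.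
Proof.
rewrite ffact_prod -[X in (_ ^ X)%N]card_ord -prod_nat_const.
by apply: leq_prod => i _; rewrite leq_sub2l // ltnW.
Qed.

Section KST.
Local Open Scope ring_scope.
Variable R : archiRealFieldType.

Lemma large_nat (a b : R) : 0 < b -> exists n0, forall n, (n0 <= n)%N ->
  a <= b * n%:R.
Proof.
move=> b0; exists (Num.truncn (a / b)).+1 => n hn.
rewrite mulrC -ler_pdivrMr //; apply/ltW/(lt_le_trans (truncnS_gt _)).
by rewrite ler_nat.
Qed.

(** Induction on [r], splitting off coordinate 0. Many [f] have at least [eps / 2 * n] extensions,
    each of these admits many injective [t]-tuples of extensions, and on average a [t]-tuple [b] is
    shared by a positive proportion of all [f]. The induction hypothesis applies to those [f]. *)
Theorem erdos_complete_partite (r t : nat) (eps : R) : 0 < eps ->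
  exists n0, forall T : finType, (n0 <= #|T|)%N ->
    forall E : {set {ffun 'I_r -> T}}, eps * #|T|%:R ^+ r <= #|E|%:R ->
    exists b : 'I_r -> 'I_t -> T, (forall i, injective (b i)) /\
      forall p : {ffun 'I_r -> 'I_t}, [ffun i => b i (p i)] \in E.
Proof.
elim: r eps => [|r IH] eps eps0.
  exists 0%N => T _ E; rewrite expr0 mulr1 => hE.
  have [phi hphi] : exists phi, phi \in E.
    apply/set0Pn; rewrite -card_gt0 -(ltr_nat R).
    exact: lt_le_trans eps0 hE.
  exists (fun i : 'I_0 => False_rect _ (notF (ltn_ord i))).
  split=> [[]|p] //; move: hphi; congr (_ \in E); by apply/ffunP=> -[].
have e2 : 0 < eps / 2 by lra.
have e4 : 0 < eps / 4 by lra.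
have e' : 0 < (eps / 2) * (eps / 4) ^+ t by rewrite mulr_gt0 ?exprn_gt0.
have [n0 Hn0] := IH _ e'.
have [n1 Hn1] := large_nat t%:R e4.
exists (maxn 1 (maxn n0 n1)) => T; rewrite !geq_max => /and3P[n_gt0 /Hn0 HT /Hn1 htn].
move=> E hE; set n := #|T| in n_gt0 HT htn hE *.
have nR : 0 < n%:R :> R by rewrite ltr0n.
pose N (f : {ffun 'I_r -> T}) := [set z | finsert ord0 z f \in E].
pose G := [set f | eps / 2 * n%:R <= #|N f|%:R].
have sumN : #|E| = (\sum_f #|N f|)%N.
  rewrite -sum1_card big_mkcond (big_finsert _ ord0) exchange_big /=.
  by apply: eq_bigr => f _; rewrite /N -sum1dep_card -big_mkcond.
have cardF : #|{ffun 'I_r -> T}| = (n ^ r)%N by rewrite card_ffun card_ord.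
have hG : eps / 2 * n%:R ^+ r <= #|G|%:R.
  have : #|E|%:R <= #|G|%:R * n%:R + eps / 2 * n%:R ^+ r.+1.
    rewrite sumN natr_sum (bigID (mem G)) /= lerD //.
      rewrite mulr_natl -sumr_const ler_sum // => f _.
      by rewrite ler_nat max_card.
    apply: le_trans (_ : \sum_(f | f \notin G) eps / 2 * n%:R <= _).
      by apply: ler_sum => f; rewrite inE -ltNge => /ltW.
    rewrite sumr_const -[leLHS]mulr_natr exprS [leRHS]mulrA.
    apply: ler_wpM2l; first by rewrite mulr_ge0 ?(ltW e2).
    by rewrite -natrX ler_nat -cardF max_card.
  rewrite exprS in hE * => h.
  rewrite -(ler_pM2r nR); nra.
pose cand := {ffun 'I_t -> T}.
pose ok (b : cand) f := injectiveb b && [forall k, b k \in N f].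
(* As [t <= eps / 4 * n], the falling factorial counting the injective choices is at least
   [(#|N f| - t) ^ t], with base at least [eps / 4 * n]. *)
have okcount f : f \in G -> (eps / 4) ^+ t * n%:R ^+ t <= #|[set b | ok b f]|%:R.
  rewrite inE => hf; have -> : #|[set b | ok b f]| = (#|N f| ^_ t)%N.
    rewrite -[X in (_ ^_ X)%N]card_ord -card_inj_ffuns_on; apply: eq_card => b.
    rewrite inE [in RHS]inE /ok andbC; congr (_ && _).
  rewrite -exprMn; apply: le_trans (_ : ((#|N f| - t) ^ t)%:R <= _); last first.
    by rewrite ler_nat ffact_ge.
  rewrite natrX; apply: lerXn2r; rewrite ?nnegrE //; first by rewrite pmulr_rge0.
  have t0 : 0 <= t%:R :> R by [].
  have htN : t%:R <= #|N f|%:R :> R by lra.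
  rewrite natrB; first by move: hf htn htN; lra.
  by rewrite -(ler_nat R).
pose E' (b : cand) := [set f | ok b f].
(* Otherwise double counting the pairs [(b, f)] with [ok b f] contradicts [okcount] on the large set
   [G]. *)
have [b hb] : exists b, eps / 2 * (eps / 4) ^+ t * n%:R ^+ r <= #|E' b|%:R :> R.
  apply/existsP; apply: contraT; rewrite negb_exists => /forallP hn.
  suff : (eps / 4) ^+ t * n%:R ^+ t * #|G|%:R <
      n%:R ^+ t * (eps / 2 * (eps / 4) ^+ t * n%:R ^+ r) :> R.
    have : 0 <= (eps / 4) ^+ t * n%:R ^+ t :> R.
      by rewrite mulr_ge0 ?exprn_ge0 ?(ltW e4).
    move=> h0; have := ler_wpM2l h0 hG; lra.
  apply: le_lt_trans (_ : \sum_b #|E' b|%:R < _).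
    apply: le_trans (_ : \sum_(f in G) #|[set b | ok b f]|%:R <= _).
      by rewrite mulr_natr -sumr_const ler_sum.
    apply: le_trans (_ : \sum_f #|[set b | ok b f]|%:R <= _).
      by rewrite big_mkcond ler_sum // => f _; case: ifP.
    rewrite -!natr_sum ler_nat.
    under eq_bigr => f _ do rewrite -sum1dep_card big_mkcond.
    under [X in (_ <= X)%N]eq_bigr => f _ do rewrite -sum1dep_card big_mkcond.
    by rewrite exchange_big.
  have -> : n%:R ^+ t * (eps / 2 * (eps / 4) ^+ t * n%:R ^+ r) =
     \sum_(b : cand) (eps / 2 * (eps / 4) ^+ t * n%:R ^+ r).
    by rewrite sumr_const card_ffun card_ord -natrX mulr_natl.
  have /card_gt0P[x _] : (0 < #|T|)%N by [].
  apply: ltr_sum => [|b _]; last by rewrite ltNge hn.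
  by apply/hasP; exists [ffun => x]; rewrite ?mem_index_enum.
have [b' [injb' Hb']] := HT (E' b) hb.
have [f0 hf0] : exists f0, f0 \in E' b.
  apply/set0Pn; rewrite -card_gt0 -(ltr_nat R); apply: lt_le_trans hb.
  by rewrite mulr_gt0 ?exprn_gt0.
have /injectiveP injb : injectiveb b by move: hf0; rewrite inE => /andP[].
exists (fun i => if unlift ord0 i is Some j then b' j else b); split.
  by move=> i; case: unlift.
move=> p; have := Hb' [ffun j => p (lift ord0 j)].
rewrite inE => /andP[_ /forallP/(_ (p ord0))]; rewrite inE.
congr (_ \in E); apply/ffunP=> i; rewrite !ffunE.
by case: unliftP => [j ->|->] //; rewrite !ffunE.
Qed.

End KST.

(** * Linear programming *)

Section LinearProgramming.
Local Open Scope ring_scope.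
Variable R : realFieldType.

Section Farkas.
Variables (V : lmodType R) (I : eqType).
Implicit Types (f : V -> R) (s : seq I).

(** Subtraction is built in because the induction below projects along a vector. *)
Definition linear_functional f := forall a x y, f (x - a *: y) = f x - a * f y.

Lemma linear_functional0 f : linear_functional f -> f 0 = 0.
Proof. by move=> fl; have := fl 1 0 0; rewrite scale1r subrr mul1r subrr. Qed.

(* Bartl's induction: when [be] is not in the cone of the functionals of [s],
   a witness [x0] of this lets one project along [x0] onto the kernel of [al i]. *)
Lemma farkas s (al : I -> V -> R) (be : V -> R) : uniq s ->
  (forall i, linear_functional (al i)) -> linear_functional be ->
  (forall x, (forall i, i \in s -> al i x <= 0) -> be x <= 0) ->
  exists la : I -> R, (forall i, 0 <= la i) /\
    forall x, be x = \sum_(i <- s) la i * al i x.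
Proof.
elim: s al be => [|i s IH] al be /=.
  move=> _ _ bel H; exists (fun=> 0); split=> // x; rewrite big_nil.
  apply/eqP; rewrite eq_le H //=.
  have : be (0 - 1 *: x) <= 0 by apply: H.
  by rewrite bel linear_functional0 //; lra.
case/andP=> his us all bel H.
case: (boolp.EM (exists x, (forall j, j \in s -> al j x <= 0) /\ 0 < be x)).
  case=> x0 [hx0 b0].
  have a0 : 0 < al i x0.
    rewrite ltNge; apply/negP => h; suff : be x0 <= 0 by rewrite leNgt b0.
    by apply: H => j; rewrite inE => /predU1P[->//|/hx0].
  pose pr x := x - (al i x / al i x0) *: x0.
  have prl f : linear_functional f -> linear_functional (fun x => f (pr x)).
    by move=> fl a x y; rewrite !fl (all i); field; rewrite gt_eqF.
  have [|||la [la0 Hla]] := IH (fun j x => al j (pr x)) (fun x => be (pr x)) us.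
  - by move=> j; apply: prl.
  - exact: prl.
  - move=> x hx; apply: H => j; rewrite inE => /predU1P[->|/hx//].
    by rewrite all divfK ?gt_eqF // subrr.
  exists (fun j => if j == i then
     (be x0 - \sum_(j <- s) la j * al j x0) / al i x0 else la j); split.
    move=> j; case: eqP => // _; rewrite divr_ge0 ?(ltW a0) // subr_ge0.
    apply: le_trans (ltW b0); rewrite big_seq; apply: sumr_le0 => k ks.
    by rewrite mulr_ge0_le0 // hx0.
  move=> x; rewrite big_cons eqxx.
  rewrite [X in _ + X](eq_big_seq (fun j => la j * al j x)); last first.
    by move=> j js /=; case: eqP his => [<-|//]; rewrite js.
  have E : \sum_(j <- s) la j * al j (pr x) = \sum_(j <- s) la j * al j x -
     al i x / al i x0 * \sum_(j <- s) la j * al j x0.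
    rewrite mulr_sumr -sumrB; apply: eq_bigr => j _.
    by rewrite /pr all; ring.
  have := Hla x; rewrite E bel => /eqP; rewrite subr_eq => /eqP ->.
  by field; rewrite gt_eqF.
move=> hn; have [|la [la0 Hla]] := IH al be us all bel.
  move=> x hx; rewrite leNgt; apply/negP => bx; apply: hn; by exists x.
exists (fun j => if j == i then 0 else la j); split; first by move=> j; case: eqP.
move=> x; rewrite big_cons eqxx mul0r add0r Hla; apply: eq_big_seq => j js /=.
by case: eqP his => [<-|//]; rewrite js.
Qed.

End Farkas.

(** * Strong duality for fractional covers and packings *)

Section Duality.
Variables (C P : finType) (A : P -> C -> R) (b : P -> R).
Hypothesis A0 : forall p v, 0 <= A p v.
Hypothesis bA : forall p, b p != 0 -> exists v, 0 < A p v.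

Let V := ({ffun C -> R^o} * {ffun P -> R^o} * R^o)%type.
Let I := (C + P + P + C + unit)%type.

(** Homogenised system in [(w, y, t)], read as [constr i x <= 0]: [w] covers [t * b], [y] packs
    within [t], and [w] costs no more than [y] earns. A solution with [t > 0] becomes an optimal
    pair after division by [t]. *)
Let constr (i : I) (x : V) : R :=
  match i with
  | inl (inl (inl (inl v))) => - x.1.1 v
  | inl (inl (inl (inr p))) => - x.1.2 p
  | inl (inl (inr p)) => b p * x.2 - \sum_v A p v * x.1.1 v
  | inl (inr v) => \sum_p A p v * x.1.2 p - x.2
  | inr _ => \sum_v x.1.1 v - \sum_p b p * x.1.2 p
  end.

Let sum_lin (J : finType) (c : J -> R) (a : R) (f g : {ffun J -> R^o}) :
  \sum_j c j * ((f - a *: g) j) = \sum_j c j * f j - a * \sum_j c j * g j.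
Proof.
rewrite mulr_sumr -sumrB; apply: eq_bigr => j _.
by rewrite !ffunE /GRing.scale /=; ring.
Qed.

Let constr_lin i : linear_functional (constr i).
Proof.
move=> a x y; case: i => [[[[v|p]|p]|v]|u] /=.
- by rewrite !ffunE /GRing.scale /=; ring.
- by rewrite !ffunE /GRing.scale /=; ring.
- by rewrite (sum_lin (A p)) /GRing.scale /=; ring.
- by rewrite (sum_lin (A^~ v)) /GRing.scale /=; ring.
- have -> : \sum_v (x - a *: y).1.1 v = \sum_v x.1.1 v - a * \sum_v y.1.1 v.
    rewrite mulr_sumr -sumrB; apply: eq_bigr => v _.
    by rewrite !ffunE /GRing.scale.
  by rewrite (sum_lin b); ring.
Qed.

(** If no solution of the homogenised system has positive scale, [farkas] writes the scale as a
    non-negative combination of the constraints. Comparing coefficients, the multipliers [p3] and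
    [p4] of the covering and packing constraints are, up to the factor [p5], a packing and a cover
    violating weak duality. *)
Theorem lp_duality : exists (w : C -> R) (y : P -> R),
  [/\ forall v, 0 <= w v, forall p, 0 <= y p,
      forall p, b p <= \sum_v A p v * w v,
      forall v, \sum_p A p v * y p <= 1 &
      \sum_v w v <= \sum_p b p * y p].
Proof.
case: (boolp.EM (exists x, (forall i, constr i x <= 0) /\ 0 < (x.2 : R))).
  case=> -[[w y] t] [H /= t0].
  have tV : 0 <= t^-1 :> R by rewrite invr_ge0 ltW.
  have tE : t != 0 :> R by rewrite gt_eqF.
  have sumt (J : finType) (c z : J -> R) :
      \sum_j c j * (z j / t) = (\sum_j c j * z j) / t.
    by rewrite mulr_suml; apply: eq_bigr => j _; rewrite mulrA.
  exists (fun v => w v / t), (fun p => y p / t); split.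
  - by move=> v; rewrite mulr_ge0 // -oppr_le0; apply: (H (inl (inl (inl (inl v))))).
  - by move=> p; rewrite mulr_ge0 // -oppr_le0; apply: (H (inl (inl (inl (inr p))))).
  - by move=> p; rewrite sumt ler_pdivlMr // -subr_le0; apply: (H (inl (inl (inr p)))).
  - by move=> v; rewrite sumt ler_pdivrMr // mul1r -subr_le0; apply: (H (inl (inr v))).
  - rewrite sumt -mulr_suml ler_wpM2r // -subr_le0; exact: (H (inr tt)).
move=> hn; have [||||la [la0 Hla]] :=
  @farkas V I (index_enum I) constr (fun x => x.2).
- exact: index_enum_uniq.
- exact: constr_lin.
- by move=> a x y.
- move=> x hx; rewrite leNgt; apply/negP => h; apply: hn; exists x; split=> // i.
  by apply: hx; rewrite mem_index_enum.
pose p3 p := la (inl (inl (inr p))); pose p4 v := la (inl (inr v)).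
pose p5 := la (inr tt).
have expand (x : V) : (x.2 : R) = \sum_v la (inl (inl (inl (inl v)))) * - x.1.1 v +
   \sum_p la (inl (inl (inl (inr p)))) * - x.1.2 p +
   \sum_p p3 p * (b p * x.2 - \sum_v A p v * x.1.1 v) +
   \sum_v p4 v * (\sum_p A p v * x.1.2 p - x.2) +
   p5 * (\sum_v x.1.1 v - \sum_p b p * x.1.2 p).
  rewrite [LHS](Hla x) !big_sumType /=; congr (_ + _).
  by rewrite (big_pred1 tt) // => -[].
have sum_delta (J : finType) (c : J -> R) (j : J) :
    \sum_k c k * ([ffun k => (k == j)%:R] : {ffun J -> R^o}) k = c j.
  rewrite (bigD1 j) //= ffunE eqxx mulr1 big1 ?addr0 // => k kj.
  by rewrite ffunE (negPf kj) mulr0.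
have sum_zero (J : finType) (c : J -> R) :
    \sum_k c k * (0 : {ffun J -> R^o}) k = 0.
  by rewrite big1 // => k _; rewrite ffunE mulr0.
have sum_zeroN (J : finType) (c : J -> R) :
    \sum_k c k * - (0 : {ffun J -> R^o}) k = 0.
  by rewrite big1 // => k _; rewrite ffunE oppr0 mulr0.
have sum_zero1 (J : finType) : \sum_k (0 : {ffun J -> R^o}) k = 0.
  by rewrite big1 // => k _; rewrite ffunE.
(* Coefficients are compared at the unit vectors: first the scale, then each [w v] and each
   [y p]. *)
have eqt : 1 = \sum_p p3 p * b p - \sum_v p4 v.
  rewrite [LHS](expand (0, 0, 1)) /= !sum_zeroN sum_zero sum_zero1 subrr mulr0.
  rewrite !add0r addr0 -sumrN; congr (_ + _); apply: eq_bigr => k _.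
    by rewrite sum_zero mulr1 subr0.
  by rewrite sum_zero add0r mulrN1.
have eqv v : \sum_p p3 p * A p v <= p5.
  have := expand ([ffun k => (k == v)%:R], 0, 0); rewrite /= sum_zeroN sum_zero.
  rewrite [X in _ + _ + X + _]big1 => [|k _]; last first.
    by rewrite sum_zero subrr mulr0.
  under [X in _ + X + _ + _]eq_bigr => p _ do rewrite sum_delta mulr0 add0r mulrN.
  rewrite sumrN subr0.
  have -> : \sum_(k : C) ([ffun k => (k == v)%:R] : {ffun C -> R^o}) k = 1.
    rewrite (bigD1 v) //= ffunE eqxx big1 ?addr0 // => k kv.
    by rewrite ffunE (negPf kv).
  have : 0 <= la (inl (inl (inl (inl v)))) by [].
  have -> : \sum_k la (inl (inl (inl (inl k)))) *
     - ([ffun k => (k == v)%:R] : {ffun C -> R^o}) k = - la (inl (inl (inl (inl v)))).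
    under eq_bigr do rewrite mulrN.
    by rewrite sumrN (sum_delta _ (fun k => la (inl (inl (inl (inl k)))))).
  lra.
have eqp p : p5 * b p <= \sum_v p4 v * A p v.
  have := expand (0, [ffun k => (k == p)%:R], 0); rewrite /= sum_zeroN sum_zero1.
  rewrite [X in _ + X + _ + _]big1 => [|k _]; last first.
    by rewrite sum_zero mulr0 subrr mulr0.
  under [X in _ + X + _]eq_bigr => v _ do rewrite (sum_delta _ (A^~ v)) subr0.
  rewrite (sum_delta _ b).
  have : 0 <= la (inl (inl (inl (inr p)))) by [].
  have -> : \sum_k la (inl (inl (inl (inr k)))) *
     - ([ffun k => (k == p)%:R] : {ffun P -> R^o}) k = - la (inl (inl (inl (inr p)))).
    under eq_bigr do rewrite mulrN.
    by rewrite sumrN (sum_delta _ (fun k => la (inl (inl (inl (inr k)))))).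
  lra.
have weak : p5 * (\sum_p p3 p * b p) <= p5 * \sum_v p4 v.
  rewrite mulr_sumr; apply: le_trans (_ : \sum_p p3 p * \sum_v p4 v * A p v <= _).
    by apply: ler_sum => p _; rewrite mulrCA ler_wpM2l //; apply: la0.
  under eq_bigr do rewrite mulr_sumr; rewrite exchange_big mulr_sumr /=.
  apply: ler_sum => v _; under eq_bigr do rewrite mulrCA.
  by rewrite -mulr_sumr mulrC ler_wpM2r //; apply: la0.
have p50 : 0 <= p5 by apply: la0.
have p40 : 0 <= \sum_v p4 v by apply: sumr_ge0 => v _; apply: la0.
(* When [p5 = 0] weak duality is void. Instead [bA] gives each row with [b p != 0] a positive entry,
   and [eqv] then forces [p3 p = 0]. *)
have p3b : p5 = 0 -> \sum_p p3 p * b p = 0.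
  move=> h; apply: big1 => p _; have [->|/bA[v Av]] := eqVneq (b p) 0.
    by rewrite mulr0.
  have : p3 p * A p v <= 0.
    rewrite -h; apply: le_trans (eqv v); rewrite (bigD1 p) //= lerDl.
    by apply: sumr_ge0 => q _; rewrite mulr_ge0 //; apply: la0.
  rewrite pmulr_lle0 // => p3n; have : 0 <= p3 p by apply: la0.
  by move=> p3p; rewrite (le_anti (_ : p3 p <= 0 <= p3 p)) ?mul0r ?p3n.
have [h|h] := eqVneq p5 0; first by rewrite p3b // in eqt; lra.
have : 0 < p5 by rewrite lt0r h.
by move=> h'; rewrite ler_pM2l // in weak; lra.
Qed.

End Duality.

(** A support larger than [#|C|] carries a linear relation between the rows of [A]. Moving [y] along
    it until a first coordinate reaches 0 keeps all loads and shrinks the support. *)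
Lemma caratheodory_cone (C P : finType) (A : P -> C -> R) (y : P -> R) :
  (forall p, 0 <= y p) ->
  exists y' : P -> R, [/\ forall p, 0 <= y' p,
    forall p, y p = 0 -> y' p = 0,
    forall v, \sum_p A p v * y' p = \sum_p A p v * y p &
    (#|[set p | y' p != 0%R]| <= #|C|)%N].
Proof.
move: {2}#|_|.+1 (ltnSn #|[set p | y p != 0]|) => m.
elim: m y => [|m IH] y; first by rewrite ltn0.
rewrite ltnS => hm y0; set S := [set p | y p != 0] in hm.
have [hS|hS] := leqP #|S| #|C|; first by exists y; split.
pose M := \matrix_(i < #|S|, j < #|C|) A (enum_val i) (enum_val j).
have : kermx M != 0.
  by rewrite kermx_eq0 /row_free neq_ltn (leq_ltn_trans (rank_leq_col M)).
case/rowV0Pn => u; rewrite sub_kermx => /eqP uM u0.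
have [i0 ui0] : exists i, u 0 i != 0.
  apply/existsP; apply: contraR u0; rewrite negb_exists => /forallP h.
  by apply/eqP/rowP=> i; rewrite mxE; apply/eqP; have := h i; rewrite negbK.
have [mu [muS mu0 [p0 hp0]]] : exists mu : P -> R, [/\ forall p, p \notin S -> mu p = 0,
    forall v, \sum_p A p v * mu p = 0 & exists p, 0 < mu p].
  pose nu p := \sum_(i | enum_val i == p) u 0 i.
  have nuE i : nu (enum_val i) = u 0 i.
    rewrite /nu (big_pred1 i) // => j /=; by rewrite (inj_eq enum_val_inj).
  have nuS p : p \notin S -> nu p = 0.
    move=> pS; rewrite /nu big_pred0 // => i; apply/eqP => h.
    by rewrite -h enum_valP in pS.
  have nu0 v : \sum_p A p v * nu p = 0.
    under eq_bigr do rewrite mulr_sumr.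
    rewrite (exchange_big_dep predT) //=.
    have := congr1 (fun X : 'rV_ _ => X 0 (enum_rank v)) uM; rewrite !mxE => h; rewrite -[RHS]h.
    apply: eq_bigr => i _; rewrite mxE enum_rankK mulrC.
    by rewrite (big_pred1 (enum_val i)) // => p; rewrite /= eq_sym.
  have [h|h] := ltrP 0 (u 0 i0).
    by exists nu; split=> //; exists (enum_val i0); rewrite nuE.
  exists (fun p => - nu p); split.
  - by move=> p /nuS ->; rewrite oppr0.
  - by move=> v; under eq_bigr do rewrite mulrN; rewrite sumrN nu0 oppr0.
  - by exists (enum_val i0); rewrite nuE oppr_gt0 lt_neqAle ui0.
(* The minimal ratio is the longest step along [- mu] keeping all coordinates non-negative; it makes
   coordinate [p1] vanish. *)
pose p1 := [arg min_(p < p0 | 0 < mu p) (y p / mu p)]%O.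
have [hp1 p1min] : 0 < mu p1 /\ forall p, 0 < mu p -> y p1 / mu p1 <= y p / mu p.
  by rewrite /p1; case: arg_minP.
pose t := y p1 / mu p1; have t0 : 0 <= t by rewrite divr_ge0 // ltW.
pose y1 p := y p - t * mu p.
have y10 p : 0 <= y1 p.
  rewrite subr_ge0; have [h|h] := ltrP 0 (mu p).
    by rewrite -ler_pdivlMr // p1min.
  by apply: le_trans (y0 p); rewrite mulr_ge0_le0.
have y1S p : y p = 0 -> y1 p = 0.
  by move=> h; rewrite /y1 h muS ?inE ?h ?eqxx // mulr0 subrr.
have y1p1 : y1 p1 = 0 by rewrite /y1 /t divfK ?subrr // gt_eqF.
have p1S : p1 \in S by apply: contraT => /muS h; rewrite h ltxx in hp1.
have [|y' [y'0 y'S y'E y'c]] := IH y1 _ y10.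
  apply: leq_trans hm; apply/proper_card/properP; split.
    by apply/subsetP=> p; rewrite !inE; apply: contra_neq => /y1S.
  by exists p1 => //; rewrite inE y1p1 eqxx.
exists y'; split=> // [p /y1S/y'S//|v].
rewrite y'E; under eq_bigr do rewrite mulrBr mulrCA.
by rewrite sumrB -mulr_sumr mu0 mulr0 subr0.
Qed.

End LinearProgramming.

(** * Tuples of weight at least one *)

Section HeavyTuples.
Local Open Scope ring_scope.
Variable R : realFieldType.

Lemma top_set (C : finType) (w : C -> R) k : (k <= #|C|)%N ->
  exists A : {set C}, #|A| = k /\ forall x y, x \in A -> y \notin A -> w y <= w x.
Proof.
elim: k => [|k IH] hk.
  by exists set0; rewrite cards0; split=> // x y; rewrite inE.
have [A [cA HA]] := IH (ltnW hk).
have [x0 hx0] : exists x, x \in ~: A.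
  by apply/card_gt0P; rewrite cardsCs setCK cA subn_gt0.
pose x1 := [arg max_(x > x0 | x \in ~: A) w x]%O.
have [hx1 Hx1] : x1 \in ~: A /\ forall y, y \in ~: A -> w y <= w x1.
  by rewrite /x1; case: arg_maxP.
exists (x1 |: A); split; first by rewrite cardsU1 cA -in_setC hx1.
move=> x y; rewrite !inE negb_or => /orP[/eqP-> /andP[_ h]|xA /andP[_ yA]].
  by apply: Hx1; rewrite inE.
exact: HA.
Qed.

(** * Heavy tuples compared with tuples meeting the heaviest vertices *)

Section TopCut.
Variables (C : finType) (w : C -> R) (A : {set C}) (th : R).
Hypothesis w0 : forall x, 0 <= w x.
Hypothesis wA : forall x, x \in A -> th <= w x.
Hypothesis wB : forall x, x \notin A -> w x <= th.

Let N : R := #|C|%:R.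
Let k : R := #|A|%:R.
Let W := \sum_(x | x \notin A) w x.
Let offA m (f : {ffun 'I_m -> C}) := [forall j, f j \notin A].
Let wsum m (f : {ffun 'I_m -> C}) := \sum_j w (f j).
(** [q] counts the tuples off [A] that one more vertex of weight [th] would make heavy; [p] counts
    the tuples off [A] paired with a vertex of [A] that leaves them light. *)
Let q m : R := \sum_(f : {ffun 'I_m -> C}) (offA f && (1 - th <= wsum f))%:R.
Let p m : R :=
  \sum_(x in A) \sum_(f : {ffun 'I_m -> C}) (offA f && (w x + wsum f < 1))%:R.

Let wsum0 m (f : {ffun 'I_m -> C}) : 0 <= wsum f.
Proof. by apply: sumr_ge0. Qed.

Let W0 : 0 <= W. Proof. by apply: sumr_ge0. Qed.

Let card_offA m : \sum_(f : {ffun 'I_m -> C}) (offA f)%:R = (N - k) ^+ m.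
Proof.
rewrite -natr_sum -big_mkcond sum1dep_card /=.
have -> : #|[set f : {ffun 'I_m -> C} | offA f]| = (#|~: A| ^ m)%N.
  rewrite -[X in (_ ^ X)%N](card_ord m) -card_ffun_on; apply: eq_card => f.
  rewrite !inE; apply/forallP/ffun_onP => H j; have := H j; by rewrite inE.
by rewrite natrX cardsCs setCK natrB ?max_card.
Qed.

Let offA_wsum_mean m :
  (N - k) * (\sum_(f : {ffun 'I_m.+1 -> C}) (offA f)%:R * wsum f) =
  m.+1%:R * W * (N - k) ^+ m.+1.
Proof.
rewrite exprS mulrCA; congr (_ * _).
under eq_bigr do rewrite mulr_sumr.
rewrite exchange_big /= -mulrA mulr_natl -[in RHS](card_ord m.+1) -sumr_const.
apply: eq_bigr => i _; rewrite (big_finsert _ i) /= mulr_suml [RHS]big_mkcond /=.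
apply: eq_bigr => x _; rewrite -card_offA.
under eq_bigr => f _.
  rewrite /offA (forall_finsert (fun x => x \notin A)) finsert_at.
  over.
case: ifP => /= [_|_]; last by rewrite big1 // => f _; rewrite mul0r.
by rewrite mulr_sumr; apply: eq_bigr => f _; rewrite mulrC.
Qed.

(** A heavy tuple is charged to each of its entries with the weight of that entry, at least 1 in
    total. Removing an entry, of weight at most [th], leaves a tuple counted by [q]. *)
Let offA_heavy m :
  \sum_(f : {ffun 'I_m.+1 -> C}) (offA f && (1 <= wsum f))%:R <=
  m.+1%:R * (W * q m).
Proof.
apply: le_trans (_ : \sum_(f : {ffun 'I_m.+1 -> C}) \sum_i
   w (f i) * (offA f && (1 <= wsum f))%:R <= _).
  apply: ler_sum => f _; rewrite -mulr_suml -/(wsum f).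
  by case: (offA f); case: (lerP 1 (wsum f)) => //= h; rewrite ?mulr1 ?mulr0.
rewrite exchange_big /= mulr_natl -[in leRHS](card_ord m.+1) -sumr_const.
apply: ler_sum => i _; rewrite (big_finsert _ i) /= mulr_suml [leRHS]big_mkcond.
apply: ler_sum => x _; under eq_bigr => f _.
  rewrite /offA (forall_finsert (fun x => x \notin A)) finsert_at.
  rewrite /wsum sum_finsert; over.
case: ifP => /= [xA|_]; last by rewrite big1 // => f _; rewrite mulr0.
rewrite mulr_sumr; apply: ler_sum => f _; rewrite ler_wpM2l // ler_nat.
rewrite -/(offA f); case: (offA f) => //=; rewrite -/(wsum f).
case: (lerP 1 _) => // h; have := wB (negbT (negbTE xA)) => hx.
by rewrite (_ : _ <= wsum f) //; lra.
Qed.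

(** Only light tuples with exactly one entry in [A] are used; the possible positions of this entry
    exclude each other. *)
Let onA_light m :
  m.+1%:R * p m <=
  \sum_(f : {ffun 'I_m.+1 -> C}) (~~ offA f && (wsum f < 1))%:R.
Proof.
pose one (f : {ffun 'I_m.+1 -> C}) i :=
  [&& f i \in A, [forall j, (j != i) ==> (f j \notin A)] & wsum f < 1].
apply: le_trans (_ : \sum_(f : {ffun 'I_m.+1 -> C}) \sum_i (one f i)%:R <= _);
    last first.
  apply: ler_sum => f _; case: (boolP [exists i, one f i]) => [/existsP[i hi]|].
    rewrite (bigD1 i) //= hi big1 ?addr0.
      case/and3P: hi => fi _ ->; rewrite andbT ler_nat lt0b.
      by apply/forallP=> /(_ i); rewrite fi.
    move=> j ji; rewrite /one; case/and3P: hi => _ /forallP/(_ j); rewrite ji /=.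
    by move=> /negPf ->.
  rewrite negb_exists => /forallP h; rewrite big1 // => i _.
  by rewrite (negPf (h i)).
rewrite exchange_big /= mulr_natl -[in leLHS](card_ord m.+1) -sumr_const.
apply: ler_sum => i _; rewrite (big_finsert _ i) /= [leLHS]big_mkcond.
apply: ler_sum => x _; case: ifP => xA; last by apply: sumr_ge0.
apply: ler_sum => f _; rewrite ler_nat /one finsert_at xA /= /wsum sum_finsert.
suff -> : [forall j, (j != i) ==> (finsert i x f j \notin A)] = offA f by [].
apply/forallP/forallP => H j.
  by have := H (lift i j); rewrite eq_sym neq_lift finsert_lift.
rewrite ffunE; case: unliftP => [j' ->|->]; last by rewrite eqxx.
by rewrite H implybT.
Qed.

(** With slack [u = k - SA], the outside weight [W] is at most [u], and since
    [N - k >= 2 * m.+1 * k] the mean weight of a tuple off [A] is at most [u / (2 * k)]. By Markov's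
    inequality at most half of these tuples are counted by [q], and the mean also bounds [p] from
    below. *)
Lemma top_cut_core m : (forall x, w x <= 1) -> \sum_x w x <= k -> 0 <= th ->
  (2 * m.+1%:R + 1) * k <= N -> 0 < k -> W * q m.+1 <= p m.+1.
Proof.
move=> w1 wk th0 hN k0; have q0 : 0 <= q m.+1 by apply: sumr_ge0.
have p0 : 0 <= p m.+1 by apply: sumr_ge0 => x _; apply: sumr_ge0.
pose SA := \sum_(x in A) w x.
have hSA : \sum_x w x = SA + W by rewrite (bigID (mem A)).
have hkth : k * th <= SA.
  by rewrite /k mulr_natl -sumr_const; apply: ler_sum.
have [hth|hth] := lerP 1 th.
  have : W <= 0 by nra.
  by move=> h; apply: le_trans p0; rewrite mulr_le0_ge0.
set kap := 1 - th; pose u := k - SA.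
have kap0 : 0 < kap by rewrite /kap; lra.
have uW : W <= u by rewrite /u; lra.
have ukap : u <= k * kap by rewrite /u /kap; lra.
pose M : R := (N - k) ^+ m.+1.
pose EZ := \sum_(f : {ffun 'I_m.+1 -> C}) (offA f)%:R * wsum f.
have hEZ : (N - k) * EZ = m.+1%:R * W * M by apply: offA_wsum_mean.
have m0 : 0 <= m%:R :> R by [].
have Nk : 0 < N - k by have : m.+1%:R = 1 + m%:R :> R by [rewrite -natr1; ring]; nra.
have M0 : 0 <= M by rewrite exprn_ge0 // ltW.
have kEZ : 2 * k * EZ <= u * M.
  rewrite -(ler_pM2l Nk).
  have -> : (N - k) * (2 * k * EZ) = 2 * m.+1%:R * k * (W * M).
    by rewrite mulrCA hEZ; ring.
  apply: le_trans (_ : (N - k) * (W * M) <= _).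
    by rewrite ler_wpM2r ?mulr_ge0 //; lra.
  by rewrite ler_wpM2l ?(ltW Nk) // ler_wpM2r.
have qEZ : q m.+1 * kap <= EZ.
  rewrite mulr_suml; apply: ler_sum => f _.
  case: (offA f); rewrite /= ?mul0r // mul1r -/kap.
  by case: (lerP kap (wsum f)) => h; rewrite ?mul1r ?mul0r.
have qM : q m.+1 * 2 <= M.
  have h1 : k * kap * (q m.+1 * 2) <= k * kap * M.
    apply: le_trans (_ : u * M <= _); last by rewrite ler_wpM2r.
    apply: le_trans kEZ; have := ler_wpM2l (ltW k0) qEZ; lra.
  by rewrite ler_pM2l ?mulr_gt0 // in h1.
(* If [wsum f < kap], an [x] in [A] has [w x + wsum f < 1] with indicator at least
   [(1 - w x - wsum f) / kap], since [0 <= 1 - w x <= kap]. *)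
have main : M * u - q m.+1 * u - k * EZ + k * kap * q m.+1 <= kap * p m.+1.
  rewrite /p exchange_big /= [leRHS]mulr_sumr.
  rewrite /M -card_offA /q /EZ !mulr_suml 2!mulr_sumr -!sumrB -big_split /=.
  apply: ler_sum => f _.
  case: (offA f) => /=; last by rewrite !mul0r !mulr0 subr0 subr0 addr0 big1 ?mulr0.
  have lower : 0 <= kap * \sum_(x in A) (w x + wsum f < 1)%R%:R.
    by rewrite mulr_ge0 ?(ltW kap0) // sumr_ge0.
  rewrite -/kap; case: (lerP kap (wsum f)) => h.
    by rewrite /= mulr1n; have := ler_wpM2l (ltW k0) h; lra.
  rewrite /= mulr0n [leRHS]mulr_sumr.
  apply: le_trans (_ : \sum_(x in A) (1 - w x - wsum f) <= _).
    rewrite !sumrB !sumr_const -[wsum f *+ _]mulr_natl -/k -/SA.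
    rewrite /u; lra.
  apply: ler_sum => x xA; case: (ltrP (w x + wsum f) 1) => h'.
    rewrite mulr1; have := wA xA; have := wsum0 f; rewrite /kap; lra.
  rewrite mulr0; lra.
have u0 : 0 <= u by apply: le_trans W0 uW.
have SA0 : 0 <= SA by apply: sumr_ge0.
(* In [main] the terms [q * u] and [k * EZ] are each at most [M * u / 2], which leaves
   [k * kap * q]. *)
rewrite -(ler_pM2l kap0); apply: le_trans main.
have h1 : kap * (W * q m.+1) <= k * kap * q m.+1.
  rewrite mulrA ler_wpM2r // mulrC ler_wpM2r ?(ltW kap0) //; lra.
have h2 := ler_wpM2l u0 qM; lra.
Qed.

(** The bound is the number of tuples meeting [A]: by the three previous estimates, heavy tuples off
    [A] are no more numerous than light tuples meeting [A]. *)
Lemma top_cut m : (forall x, w x <= 1) -> \sum_x w x <= k -> 0 <= th ->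
  (2 * m.+1%:R + 1) * k <= N -> 0 < k ->
  (#|[set f : {ffun 'I_m.+2 -> C} | 1%R <= wsum f]|)%:R <= N ^+ m.+2 - (N - k) ^+ m.+2.
Proof.
move=> w1 wk th0 hN k0; have core := top_cut_core w1 wk th0 hN k0.
have heavy := offA_heavy m.+1; have light := onA_light m.+1.
rewrite -(card_offA m.+2) -sum1dep_card natr_sum big_mkcond /=.
have -> : N ^+ m.+2 = \sum_(f : {ffun 'I_m.+2 -> C}) 1.
  by rewrite sumr_const card_ffun card_ord natrX.
have : m.+2%:R * (W * q m.+1) <= m.+2%:R * p m.+1 by rewrite ler_wpM2l.
move=> hm; rewrite -sumrB -subr_ge0 -sumrB.
have : 0 <= \sum_(f : {ffun 'I_m.+2 -> C}) ((~~ offA f && (wsum f < 1))%:R -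
   (offA f && (1 <= wsum f))%:R : R).
  rewrite sumrB; lra.
move=> h; apply: le_trans h _; apply: ler_sum => f _.
case: (offA f); case: (lerP 1 (wsum f)) => /= _; rewrite ?mulr0n ?mulr1n; lra.
Qed.

End TopCut.

(** [top_cut] is applied with [A] the [k] heaviest vertices and [th] the largest weight outside
    [A]. *)
Theorem heavy_count (C : finType) (w : C -> R) m k :
  (forall x, 0 <= w x) -> \sum_x w x <= k%:R -> ((2 * m.+1 + 1) * k <= #|C|)%N ->
  (#|[set f : {ffun 'I_m.+2 -> C} | 1%R <= \sum_j w (f j)]|)%:R <=
    #|C|%:R ^+ m.+2 - (#|C|%:R - k%:R) ^+ m.+2 :> R.
Proof.
move=> w0 wk hk; have [k0|k_gt0] := posnP k.
  rewrite k0 subr0 subrr; have wz x : w x = 0.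
    apply: le_anti; rewrite w0 andbT; move: wk; rewrite k0; apply: le_trans.
    by rewrite (bigD1 x) //= lerDl sumr_ge0.
  rewrite (_ : [set _ | _] = set0) ?cards0 //; apply/setP=> f; rewrite !inE.
  by rewrite big1 ?ler10 // => j _; rewrite wz.
(* Truncation at 1 keeps heavy tuples heavy, since an entry of weight at least 1 suffices by
   itself. *)
pose w' x := Num.min (w x) 1.
have w'0 x : 0 <= w' x by rewrite /w' le_min w0 ler01.
have w'1 x : w' x <= 1 by rewrite /w' ge_min lexx orbT.
have hkC : (k < #|C|)%N by nia.
have [A [cA HA]] := top_set w' (ltnW hkC).
have [x0 hx0] : exists x, x \in ~: A.
  by apply/card_gt0P; rewrite cardsCs setCK cA subn_gt0.
pose x1 := [arg max_(x > x0 | x \in ~: A) w' x]%O.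
have [hx1 Hx1] : x1 \in ~: A /\ forall y, y \in ~: A -> w' y <= w' x1.
  by rewrite /x1; case: arg_maxP.
have kR : 0 < #|A|%:R :> R by rewrite cA ltr0n.
have := @top_cut C w' A (w' x1) w'0 _ _ m w'1 _ _ _ kR.
rewrite cA => H; apply: le_trans (H _ _ _ _ _).
- rewrite ler_nat; apply/subset_leq_card/subsetP => f; rewrite !inE => hf.
  case: (boolP [exists j, 1 <= w (f j)]) => [/existsP[j hj]|].
    rewrite (bigD1 j) //= /w' (min_idPr hj) lerDl.
    by apply: sumr_ge0 => i _; apply: w'0.
  rewrite negb_exists => /forallP h; apply: le_trans hf _; apply: ler_sum => j _.
  by rewrite /w' le_min lexx /=; have := h j; rewrite -ltNge; apply: ltW.
- by move=> x xA; apply: HA => //; rewrite -in_setC.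
- by move=> x xA; apply: Hx1; rewrite in_setC.
- by apply: le_trans wk; apply: ler_sum => x _; rewrite /w' ge_min lexx.
- exact: w'0.
- by rewrite -(ler_nat R) natrM natrD natrM in hk.
Qed.

End HeavyTuples.

(** * Heavy sums across three triples of total weight 1 *)

Section Triples.
Local Open Scope ring_scope.
Variable R : realFieldType.
Implicit Types (a b c : R * R * R) (g : R -> R).

Definition heavy (s : R) : R := (1 <= s)%R%:R.
Local Notation I := heavy.

Definition tsum g a := g a.1.1 + g a.1.2 + g a.2.
Definition unit_triple a := [/\ 0 <= a.1.1, 0 <= a.1.2, 0 <= a.2 & a.1.1 + a.1.2 + a.2 = 1].
Definition sorted3 a := (a.1.2 <= a.1.1) && (a.2 <= a.1.2).

Definition heavy1 a := tsum I a.
Definition heavy2 a b := tsum (fun x => tsum (fun y => I (x + y)) b) a.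
Definition heavy3 a b c :=
  tsum (fun x => tsum (fun y => tsum (fun z => I (x + y + z)) c) b) a.

Lemma heavy_le1 s : I s <= 1. Proof. by rewrite /I; case: (1 <= s). Qed.
Lemma heavy_light s : s < 1 -> I s = 0.
Proof. by rewrite /I ltNge => /negPf ->. Qed.
Lemma heavy_heavy s : 1 <= s -> I s = 1. Proof. by rewrite /I => ->. Qed.

Lemma heavy_excl s t : s + t < 2 -> I s + I t <= 1.
Proof.
move=> h; have [h1|h1] := lerP 1 s.
  by rewrite (@heavy_light t) ?addr0 ?heavy_le1 //; lra.
by rewrite heavy_light // add0r heavy_le1.
Qed.

Lemma eq_tsum g h a : g =1 h -> tsum g a = tsum h a.
Proof. by move=> e; rewrite /tsum !e. Qed.

Lemma tsum_exchange (F : R -> R -> R) a b :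
  tsum (fun x => tsum (F x) b) a = tsum (fun y => tsum (F^~ y) a) b.
Proof. by rewrite /tsum /=; ring. Qed.

Lemma heavy2C a b : heavy2 a b = heavy2 b a.
Proof.
rewrite /heavy2 tsum_exchange; apply: eq_tsum => y; apply: eq_tsum => x /=.
by rewrite addrC.
Qed.

Lemma heavy3C a b c : heavy3 a b c = heavy3 b a c.
Proof.
rewrite /heavy3 tsum_exchange; apply: eq_tsum => y; apply: eq_tsum => x /=.
by apply: eq_tsum => z; rewrite (addrC x).
Qed.

Lemma heavy3AC a b c : heavy3 a b c = heavy3 a c b.
Proof.
apply: eq_tsum => x; rewrite tsum_exchange; apply: eq_tsum => y.
by apply: eq_tsum => z /=; rewrite addrAC.
Qed.

Lemma sort_triple a : unit_triple a ->
  exists b, [/\ unit_triple b, sorted3 b & forall g, tsum g a = tsum g b].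
Proof.
case: a => [[x y] z]; rewrite /unit_triple /sorted3 /tsum /= => -[x0 y0 z0 s].
have [h1|/ltW h1] := lerP y x; have [h2|/ltW h2] := lerP z y;
  have [h3|/ltW h3] := lerP z x.
- by exists (x, y, z); split=> /=; rewrite ?h1.
- by exists (x, y, z); split=> /=; rewrite ?h1.
- exists (x, z, y); split=> /= [||g]; [split=> //; lra|by rewrite h3|ring].
- exists (z, x, y); split=> /= [||g]; [split=> //; lra|by rewrite h3|ring].
- exists (y, x, z); split=> /= [||g]; [split=> //; lra|by rewrite h1|ring].
- exists (y, z, x); split=> /= [||g]; [split=> //; lra|by rewrite h2|ring].
- exists (z, y, x); split=> /= [||g]; [split=> //; lra|by rewrite h2|ring].
- exists (z, y, x); split=> /= [||g]; [split=> //; lra|by rewrite h2|ring].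
Qed.

Section Complement.
Variables a1 a2 a3 b1 b2 b3 c1 c2 c3 : R.
Let a := (a1, a2, a3).
Let b := (b1, b2, b3).
Let c := (c1, c2, c3).
Hypotheses (ua : unit_triple a) (ub : unit_triple b) (uc : unit_triple c).
Hypothesis c1_gt0 : 0 < c1.

Let sa : a1 + a2 + a3 = 1. Proof. by case: ua. Qed.
Let sb : b1 + b2 + b3 = 1. Proof. by case: ub. Qed.
Let sc : c1 + c2 + c3 = 1. Proof. by case: uc. Qed.

Let row x y := I (x + y + c1) + I (x + y + c2) + I (x + y + c3).

Let row_le3 x y : row x y <= 3.
Proof.
have := heavy_le1 (x + y + c1); have := heavy_le1 (x + y + c2).
by have := heavy_le1 (x + y + c3); rewrite /row; lra.
Qed.

(* The disjoint triples [x, y, c2] and [x', y', c3] have total weight at most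
   [1 + c2 + c3 < 2], hence are not both heavy; likewise with [c2], [c3] swapped. *)
Let rows_le4 x y x' y' : x + x' + (y + y') <= 1 -> row x y + row x' y' <= 4.
Proof.
move=> h; have := heavy_le1 (x + y + c1); have := heavy_le1 (x' + y' + c1).
have excl z z' : z + z' < 1 -> I (x + y + z) + I (x' + y' + z') <= 1.
  by move=> hz; apply: heavy_excl; lra.
have := @excl c2 c3; have := @excl c3 c2; rewrite /row; move: sc c1_gt0 => s0 p0.
have l1 : c3 + c2 < 1 by lra.
by have l2 : c2 + c3 < 1 by [lra]; move=> /(_ l1) ? /(_ l2) ? ? ?; lra.
Qed.

Let heavy3_rows : heavy3 a b c = row a1 b1 + row a1 b2 + row a1 b3 +
  (row a2 b1 + row a2 b2 + row a2 b3) + (row a3 b1 + row a3 b2 + row a3 b3).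
Proof. by []. Qed.

(** Nine rows of at most 3 would give 27. By the hypothesis the remaining weights of [a] and [b] sum
    to at most 1, so [rows_le4] saves 2 on each of two disjoint pairs of rows. *)
Lemma heavy3_le23 : 1 <= a1 + b1 -> heavy3 a b c <= 23.
Proof.
move=> h11; rewrite heavy3_rows; move: sa sb => s1 s2.
have /rows_le4 p1 : a2 + a3 + (b2 + b3) <= 1 by lra.
have /rows_le4 p2 : a2 + a3 + (b3 + b2) <= 1 by lra.
have := row_le3 a1 b1; have := row_le3 a1 b2; have := row_le3 a1 b3.
by have := row_le3 a2 b1; have := row_le3 a3 b1; lra.
Qed.

(** As before, with three disjoint pairs of rows. *)
Lemma heavy3_le21_row :
  1 <= a1 + b3 -> 1 <= a1 + b1 -> 1 <= a1 + b2 -> heavy3 a b c <= 21.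
Proof.
move=> h13 h11 h12; rewrite heavy3_rows; move: sa sb => s1 s2.
have /rows_le4 p1 : a2 + a3 + (b1 + b2) <= 1 by lra.
have /rows_le4 p2 : a2 + a3 + (b2 + b3) <= 1 by lra.
have /rows_le4 p3 : a2 + a3 + (b3 + b1) <= 1 by lra.
by have := row_le3 a1 b1; have := row_le3 a1 b2; have := row_le3 a1 b3; lra.
Qed.

(** Again three disjoint pairs, chosen outside the three rows that the hypotheses name. *)
Lemma heavy3_le21_corner :
  1 <= a1 + b1 -> 1 <= a1 + b2 -> 1 <= a2 + b1 -> heavy3 a b c <= 21.
Proof.
move=> h11 h12 h21; rewrite heavy3_rows; move: sa sb => s1 s2.
have /rows_le4 p1 : a2 + a3 + (b2 + b3) <= 1 by lra.
have /rows_le4 p2 : a2 + a3 + (b3 + b1) <= 1 by lra.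
have /rows_le4 p3 : a3 + a1 + (b2 + b3) <= 1 by lra.
by have := row_le3 a1 b1; have := row_le3 a1 b2; have := row_le3 a2 b1; lra.
Qed.

End Complement.

Lemma heavy2_row0 b : unit_triple b -> tsum (fun y => I (1 + y)) b = 3.
Proof.
case=> h1 h2 h3 _; rewrite /tsum !heavy_heavy; first by ring.
all: by rewrite lerDl.
Qed.

Lemma star_triple a : unit_triple a -> sorted3 a -> 1 <= a.1.1 -> a = (1, 0, 0).
Proof.
case: a => [[x y] z]; rewrite /unit_triple /sorted3 /= => -[x0 y0 z0 s] _ h.
by congr (_, _, _); lra.
Qed.

Lemma nonstar_heavy1 a : unit_triple a -> sorted3 a -> a.1.1 < 1 -> heavy1 a = 0.
Proof.
case: a => [[x y] z]; rewrite /sorted3 /heavy1 /tsum /= => _ /andP[h1 h2] h.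
by rewrite !heavy_light; lra.
Qed.

Lemma heavy1_star : heavy1 (1, 0, 0) = 1.
Proof. by rewrite /heavy1 /tsum /= heavy_heavy // !heavy_light ?ltr01 // !addr0. Qed.

Lemma tsum_zero_row b : tsum (fun y => I (0 + y)) b = heavy1 b.
Proof. by apply: eq_tsum => y; rewrite add0r. Qed.

Lemma heavy2_star b : unit_triple b -> heavy2 (1, 0, 0) b = 3 + 2 * heavy1 b.
Proof.
move=> ub; rewrite {1}/heavy2 {1}/tsum /= heavy2_row0 // tsum_zero_row; ring.
Qed.

Lemma heavy3_star b c : unit_triple b -> unit_triple c ->
  heavy3 (1, 0, 0) b c = 9 + 2 * heavy2 b c.
Proof.
move=> [b1 b2 b3 _] [c1 c2 c3 _]; rewrite {1}/heavy3 {1}/tsum /=.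
have -> : tsum (fun y => tsum (fun z => I (0 + y + z)) c) b = heavy2 b c.
  by apply: eq_tsum => y; apply: eq_tsum => z; rewrite add0r.
rewrite /tsum !heavy_heavy; first by ring.
all: by rewrite -addrA lerDl addr_ge0.
Qed.

(** A heavy pair between [a] and [b] makes the complementary pairs weigh little, which costs heavy
    triples with any third [c]. The cases follow the heavy positions in the 3 by 3 table of sums,
    monotone because the triples are sorted. *)
Lemma heavy2_nonstar a b : unit_triple a -> unit_triple b ->
  sorted3 a -> sorted3 b -> a.1.1 < 1 -> b.1.1 < 1 ->
  [\/ heavy2 a b = 0,
      heavy2 a b <= 2 /\ forall c, unit_triple c -> 0 < c.1.1 -> heavy3 a b c <= 23 |
      heavy2 a b <= 4 /\ forall c, unit_triple c -> 0 < c.1.1 -> heavy3 a b c <= 21].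
Proof.
case: a b => [[a1 a2] a3] [[b1 b2] b3] ua ub.
case: (ua) (ub) => /= a10 a20 a30 sa [/= b10 b20 b30 sb].
rewrite /sorted3 /= => /andP[a21 a32] /andP[b21 b32] a11 b11.
have [h11|h11] := ltrP (a1 + b1) 1.
  by apply: Or31; rewrite /heavy2 /tsum /= !heavy_light ?addr0 //; lra.
have z23 : I (a2 + b3) = 0 by apply: heavy_light; lra.
have z32 : I (a3 + b2) = 0 by apply: heavy_light; lra.
have z33 : I (a3 + b3) = 0 by apply: heavy_light; lra.
have m12 := heavy_le1 (a1 + b2); have m21 := heavy_le1 (a2 + b1).
have m11 := heavy_le1 (a1 + b1); have m13 := heavy_le1 (a1 + b3).
have m22 := heavy_le1 (a2 + b2); have m31 := heavy_le1 (a3 + b1).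
have E : heavy2 (a1, a2, a3) (b1, b2, b3) = I (a1 + b1) + I (a1 + b2) + I (a1 + b3) +
    (I (a2 + b1) + I (a2 + b2)) + I (a3 + b1).
  by rewrite /heavy2 /tsum /= z23 z32 z33 !addr0.
rewrite E.
have [h13|h13] := lerP 1 (a1 + b3).
  have z21 : I (a2 + b1) = 0 by apply: heavy_light; lra.
  have z22 : I (a2 + b2) = 0 by apply: heavy_light; lra.
  have z31 : I (a3 + b1) = 0 by apply: heavy_light; lra.
  apply: Or33; split=> [|[[c1 c2] c3] uc /= c0]; first by lra.
  by apply: heavy3_le21_row => //; lra.
have [h31|h31] := lerP 1 (a3 + b1).
  have z12 : I (a1 + b2) = 0 by apply: heavy_light; lra.
  have z22 : I (a2 + b2) = 0 by apply: heavy_light; lra.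
  have z13 := heavy_light h13.
  apply: Or33; split=> [|[[c1 c2] c3] uc /= c0]; first by lra.
  by rewrite heavy3C; apply: heavy3_le21_row => //; lra.
have z13 := heavy_light h13; have z31 := heavy_light h31.
have [h12|h12] := lerP 1 (a1 + b2); have [h21|h21] := lerP 1 (a2 + b1).
- apply: Or33; split=> [|[[c1 c2] c3] uc /= c0]; first by lra.
  exact: heavy3_le21_corner.
- have z21 := heavy_light h21; have z22 : I (a2 + b2) = 0 by apply: heavy_light; lra.
  apply: Or32; split=> [|[[c1 c2] c3] uc /= c0]; first by lra.
  exact: heavy3_le23.
- have z12 := heavy_light h12; have z22 : I (a2 + b2) = 0 by apply: heavy_light; lra.
  apply: Or32; split=> [|[[c1 c2] c3] uc /= c0]; first by lra.
  exact: heavy3_le23.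
- have z12 := heavy_light h12; have z22 : I (a2 + b2) = 0 by apply: heavy_light; lra.
  have z21 := heavy_light h21.
  apply: Or32; split=> [|[[c1 c2] c3] uc /= c0]; first by lra.
  exact: heavy3_le23.
Qed.

Lemma heavy3_le27 a b c : heavy3 a b c <= 27.
Proof.
have le3 g d : (forall x, g x <= 3) -> tsum g d <= 9.
  by move=> h; have := h d.1.1; have := h d.1.2; have := h d.2; rewrite /tsum; lra.
have le1 g d : (forall x, g x <= 1) -> tsum g d <= 3.
  by move=> h; have := h d.1.1; have := h d.1.2; have := h d.2; rewrite /tsum; lra.
have le9 g d : (forall x, g x <= 9) -> tsum g d <= 27.
  by move=> h; have := h d.1.1; have := h d.1.2; have := h d.2; rewrite /tsum; lra.
by apply: le9 => x; apply: le3 => y; apply: le1 => z; apply: heavy_le1.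
Qed.

Lemma unit_triple_max_gt0 a : unit_triple a -> sorted3 a -> 0 < a.1.1.
Proof. by case=> _ _ _ s /andP[h1 h2]; lra. Qed.

Let light_bounds (n x : R) := [\/ x = 0, x <= 2 /\ n <= 23 | x <= 4 /\ n <= 21].

Let score_arith (rho n x y z : R) : 0 <= rho -> n <= 27 ->
  light_bounds n x -> light_bounds n y -> light_bounds n z ->
  n + rho * (x + y + z) <= Num.max 27 (19 + 15 * rho + 3 * rho ^+ 2).
Proof.
move=> r0 n27.
have key t : light_bounds n t -> [/\ t <= 4, 21 < n -> t <= 2 & 23 < n -> t <= 0].
  by case=> [->|[h h']|[h h']]; split=> *; lra.
case/key=> k1 l1 m1 /key[k2 l2 m2] /key[k3 l3 m3].
have : [\/ x + y + z <= 0, x + y + z <= 6 /\ n <= 23 | x + y + z <= 12 /\ n <= 21].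
  have [h|/[dup] h /[dup] /l1 {}l1 /[dup] /l2 {}l2 /l3 {}l3] := lerP n 21.
    by apply: Or33; split=> //; lra.
  have [h'|/[dup] h' /[dup] /m1 {}m1 /[dup] /m2 {}m2 /m3 {}m3] := lerP n 23.
    by apply: Or32; split=> //; lra.
  by apply: Or31; lra.
move: (x + y + z) => s H {key k1 l1 m1 k2 l2 m2 k3 l3 m3}.
(* At [rho = 1 / 2] the critical value [21 + 12 * rho] equals 27. *)
rewrite le_max; apply/orP; have [hr|hr] := lerP rho (1 / 2).
  by left; case: H => [h|[h h']|[h h']]; have := ler_wpM2l r0 h; lra.
right; have hr2 := ler_wpM2l r0 (ltW hr).
by case: H => [h|[h h']|[h h']]; have := ler_wpM2l r0 h; lra.
Qed.

(* Weighted number of heavy triples, each vertex being either taken in one of the unit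
   triples [a], [b], [c] (with weight 1) or of weight 0 (with weight [rho]).  The value 27
   is attained by three copies of (1/3, 1/3, 1/3), and 19 + 15 rho + 3 rho^2 by three
   copies of (1, 0, 0). *)
Definition triple_score (rho : R) a b c :=
  heavy3 a b c + rho * (heavy2 a b + heavy2 a c + heavy2 b c) +
  rho ^+ 2 * (heavy1 a + heavy1 b + heavy1 c).

(** A triple with an entry of weight at least 1 is [(1, 0, 0)], for which the score reduces to
    counts on the other two triples. Otherwise no single entry is heavy, and the trade-off of
    [heavy2_nonstar] applies to all three pairs. *)
Lemma triple_score_le_sorted rho a b c : 0 <= rho ->
  unit_triple a -> unit_triple b -> unit_triple c ->
  sorted3 a -> sorted3 b -> sorted3 c ->
  triple_score rho a b c <= Num.max 27 (19 + 15 * rho + 3 * rho ^+ 2).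
Proof.
move=> r0 ua ub uc oa ob oc; rewrite le_max.
have star x y : unit_triple x -> unit_triple y -> sorted3 x -> sorted3 y ->
   triple_score rho (1, 0, 0) x y <= 19 + 15 * rho + 3 * rho ^+ 2.
  move=> ux uy ox oy; rewrite /triple_score heavy3_star // !heavy2_star // heavy1_star.
  have rr : 0 <= rho ^+ 2 by apply: exprn_ge0.
  have [hx|hx] := lerP 1 x.1.1.
    rewrite (star_triple ux ox hx) heavy2_star // heavy1_star.
    have [hy|hy] := lerP 1 y.1.1.
      by rewrite (star_triple uy oy hy) heavy1_star; lra.
    by rewrite (nonstar_heavy1 uy oy hy); lra.
  rewrite (nonstar_heavy1 ux ox hx).
  have [hy|hy] := lerP 1 y.1.1.
    rewrite (star_triple uy oy hy) heavy2C heavy2_star // heavy1_star.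
    by rewrite (nonstar_heavy1 ux ox hx); lra.
  rewrite (nonstar_heavy1 uy oy hy).
  have h4 : heavy2 x y <= 4.
    by case: (heavy2_nonstar ux uy ox oy hx hy) => [->|[h _]|[h _]] //; lra.
  have := ler_wpM2l r0 h4; lra.
have [ha|ha] := lerP 1 a.1.1.
  by rewrite (star_triple ua oa ha) star ?orbT.
have [hb|hb] := lerP 1 b.1.1.
  suff -> : triple_score rho a b c = triple_score rho b a c.
    by rewrite (star_triple ub ob hb) star ?orbT.
  by rewrite /triple_score heavy3C (heavy2C a b); ring.
have [hc|hc] := lerP 1 c.1.1.
  suff -> : triple_score rho a b c = triple_score rho c a b.
    by rewrite (star_triple uc oc hc) star ?orbT.
  rewrite /triple_score heavy3AC heavy3C (heavy2C a c) (heavy2C b c); ring.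
rewrite /triple_score !nonstar_heavy1 // !addr0 mulr0 addr0 -le_max.
have pa := unit_triple_max_gt0 ua oa; have pb := unit_triple_max_gt0 ub ob.
have pc := unit_triple_max_gt0 uc oc.
set n3 := heavy3 a b c; set s2 := _ + _ + _.
have eac : heavy3 a c b = n3 by rewrite heavy3AC.
have ebc : heavy3 b c a = n3 by rewrite /n3 (heavy3C a b) (heavy3AC b a).
have n27 : n3 <= 27 by apply: heavy3_le27.
pose bounds := light_bounds n3.
have Hab : bounds (heavy2 a b).
  case: (heavy2_nonstar ua ub oa ob ha hb) => [h|[h /(_ c uc pc) h']|[h /(_ c uc pc) h']].
  - exact: Or31.
  - exact: Or32.
  - exact: Or33.
have Hac : bounds (heavy2 a c).
  rewrite /bounds /light_bounds -eac.
  case: (heavy2_nonstar ua uc oa oc ha hc) => [h|[h /(_ b ub pb) h']|[h /(_ b ub pb) h']].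
  - exact: Or31.
  - exact: Or32.
  - exact: Or33.
have Hbc : bounds (heavy2 b c).
  rewrite /bounds /light_bounds -ebc.
  case: (heavy2_nonstar ub uc ob oc hb hc) => [h|[h /(_ a ua pa) h']|[h /(_ a ua pa) h']].
  - exact: Or31.
  - exact: Or32.
  - exact: Or33.
exact: (@score_arith rho n3 _ _ _ r0 n27 Hab Hac Hbc).
Qed.

Lemma triple_score_le rho a b c : 0 <= rho ->
  unit_triple a -> unit_triple b -> unit_triple c ->
  triple_score rho a b c <= Num.max 27 (19 + 15 * rho + 3 * rho ^+ 2).
Proof.
move=> r0 /sort_triple[a' [ua oa Ea]] /sort_triple[b' [ub ob Eb]].
move=> /sort_triple[c' [uc oc Ec]].
suff -> : triple_score rho a b c = triple_score rho a' b' c'.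
  exact: triple_score_le_sorted.
have E2 x x' y y' : (forall g, tsum g x = tsum g x') ->
    (forall g, tsum g y = tsum g y') -> heavy2 x y = heavy2 x' y'.
  by move=> e e'; rewrite /heavy2 e; apply: eq_tsum => z; rewrite e'.
have E3 : heavy3 a b c = heavy3 a' b' c'.
  rewrite /heavy3 Ea; apply: eq_tsum => x; rewrite Eb; apply: eq_tsum => y.
  by rewrite Ec.
rewrite /triple_score E3 (E2 a a' b b') // (E2 a a' c c') // (E2 b b' c c') //.
by rewrite /heavy1 Ea Eb Ec.
Qed.

End Triples.

Arguments heavy {R} s.

(** * Heavy triples of vertices under complementary slackness *)

Section HeavyTriples.
Local Open Scope ring_scope.
Variable R : realFieldType.
Variables (C : finType) (w : C -> R) (y : {ffun 'I_3 -> C} -> R).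

Let load v := \sum_f y f * \sum_i (f i == v)%:R.

Hypothesis w0 : forall v, 0 <= w v.
Hypothesis y0 : forall f, 0 <= y f.
Hypothesis load1 : forall v, load v <= 1.
Hypothesis y_tight : forall f, y f != 0 -> \sum_i w (f i) = 1.
Hypothesis w_tight : forall v, w v != 0 -> load v = 1.

Let s := \sum_f y f.
(** The uncovered mass of the vertices; by [w_tight] it sits on vertices of weight 0. *)
Let zeta := \sum_v (1 - load v).
Let wt (f : {ffun 'I_3 -> C}) := (w (f 0), w (f 1), w (f 2%:R)).
Let E (g : R -> R) := \sum_f y f * tsum g (wt f).

Let sum_wt (g : R -> R) (f : {ffun 'I_3 -> C}) : \sum_i g (w (f i)) = tsum g (wt f).
Proof.
rewrite !big_ord_recl big_ord0 addr0 addrA /tsum /=.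
by congr (g (w (f _)) + g (w (f _)) + g (w (f _))); apply/val_inj.
Qed.

Let sum_load (g : C -> R) : \sum_v load v * g v = \sum_f y f * \sum_i g (f i).
Proof.
under eq_bigr do rewrite mulr_suml; rewrite exchange_big /=.
apply: eq_bigr => f _; under eq_bigr do rewrite -mulrA mulr_suml.
rewrite -mulr_sumr exchange_big /=; congr (_ * _); apply: eq_bigr => i _.
rewrite (bigD1 (f i)) //= eqxx mul1r big1 ?addr0 // => v hv.
by rewrite eq_sym (negPf hv) mul0r.
Qed.

Let zetaE : zeta = #|C|%:R - 3 * s.
Proof.
rewrite /zeta sumrB sumr_const; congr (_ - _).
have := sum_load (fun=> 1); under eq_bigr do rewrite mulr1; move=> ->.
rewrite mulr_sumr; apply: eq_bigr => f _.
by rewrite sumr_const card_ord mulrC.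
Qed.

(* Complementary slackness: the vertices outside the fractional matching weigh 0. *)
Let sum_split (g : R -> R) : \sum_v g (w v) = E g + zeta * g 0.
Proof.
rewrite /E; under [X in X + _]eq_bigr do rewrite -sum_wt.
rewrite -(sum_load (fun v => g (w v))) mulr_suml -big_split /=.
apply: eq_bigr => v _; have [->|/w_tight ->] := eqVneq (w v) 0; ring.
Qed.

Let E_lin (g h : R -> R) a : E (fun x => g x + a * h x) = E g + a * E h.
Proof.
rewrite /E mulr_sumr -big_split /=; apply: eq_bigr => f _.
by rewrite /tsum; ring.
Qed.

Let eq_E (g h : R -> R) : g =1 h -> E g = E h.
Proof. by move=> gh; apply: eq_bigr => f _; rewrite (eq_tsum _ gh). Qed.

Let unit_wt f : y f != 0 -> unit_triple (wt f).
Proof.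
move=> /y_tight h; split=> //=.
by move: h; rewrite (sum_wt id).
Qed.

Let sum_ffun r (F : R -> R) :
  \sum_(f : {ffun 'I_r.+1 -> C}) F (\sum_j w (f j)) =
  \sum_x \sum_(f : {ffun 'I_r -> C}) F (w x + \sum_j w (f j)).
Proof.
rewrite (big_finsert _ ord0) /=; apply: eq_bigr => x _; apply: eq_bigr => f _.
by rewrite sum_finsert.
Qed.

Let count3 : (#|[set f : {ffun 'I_3 -> C} | (1 <= \sum_j w (f j))%R]|)%:R =
  \sum_x \sum_z \sum_t heavy (w x + w z + w t).
Proof.
rewrite -sum1dep_card natr_sum big_mkcond /=.
under eq_bigr => f _.
  rewrite (_ : (if _ then _ else _) = heavy (\sum_j w (f j))); last first.
    by rewrite /heavy; case: ifP.
  over.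
rewrite (sum_ffun 2 heavy); apply: eq_bigr => x _.
rewrite (sum_ffun 1 (fun t => heavy (w x + t))); apply: eq_bigr => z _.
rewrite (sum_ffun 0 (fun t => heavy (w x + (w z + t)))); apply: eq_bigr => t _.
under eq_bigr do rewrite big_ord0 addr0 addrA.
by rewrite sumr_const card_ffun card_ord expn0.
Qed.

(** [sum_split] in each of the three variables: an uncovered coordinate gives a factor [zeta] and
    weight 0. The cubic term in [zeta] drops out as [heavy 0 = 0]. *)
Let count_expand : \sum_x \sum_z \sum_t heavy (w x + w z + w t) =
  E (fun x => E (fun z => E (fun t => heavy (x + z + t)))) +
  3 * zeta * E (fun x => E (fun z => heavy (x + z))) +
  3 * zeta ^+ 2 * E heavy.
Proof.
have inner x z : \sum_t heavy (x + z + w t) =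
    E (fun t => heavy (x + z + t)) + zeta * heavy (x + z).
  by rewrite (sum_split (fun t => heavy (x + z + t))) addr0.
have mid x : \sum_z \sum_t heavy (x + w z + w t) =
    E (fun z => E (fun t => heavy (x + z + t))) + zeta * E (fun z => heavy (x + z)) +
    zeta * (E (fun t => heavy (x + t)) + zeta * heavy x).
  under eq_bigr do rewrite inner.
  rewrite (sum_split (fun z => E (fun t => heavy (x + z + t)) + zeta * heavy (x + z))).
  by rewrite E_lin addr0.
under eq_bigr do rewrite mid.
rewrite (sum_split (fun x => E (fun z => E (fun t => heavy (x + z + t))) +
    zeta * E (fun z => heavy (x + z)) +
    zeta * (E (fun t => heavy (x + t)) + zeta * heavy x))).
rewrite !E_lin.
have z1 : E (fun z => E (fun t => heavy (0 + z + t))) = E (fun x => E (fun z => heavy (x + z))).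
  by apply: eq_E => z; apply: eq_E => t; rewrite add0r.
have z2 : E (fun z => heavy (0 + z)) = E heavy by apply: eq_E => z; rewrite add0r.
rewrite z1 z2 (@heavy_light _ 0) //; ring.
Qed.

Let E1 : E heavy = \sum_f y f * heavy1 (wt f). Proof. by []. Qed.

Let E2 : E (fun x => E (fun z => heavy (x + z))) =
  \sum_f \sum_g y f * y g * heavy2 (wt f) (wt g).
Proof.
apply: eq_bigr => f _; rewrite /tsum /E -!big_split /= mulr_sumr.
by apply: eq_bigr => g _; rewrite /heavy2 /tsum /=; ring.
Qed.

Let E3 : E (fun x => E (fun z => E (fun t => heavy (x + z + t)))) =
  \sum_f \sum_g \sum_h y f * y g * y h * heavy3 (wt f) (wt g) (wt h).
Proof.
have inner x : E (fun z => E (fun t => heavy (x + z + t))) = \sum_g \sum_h y g * y h *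
    tsum (fun z => tsum (fun t => heavy (x + z + t)) (wt h)) (wt g).
  apply: eq_bigr => f _; rewrite /tsum /E -!big_split /= mulr_sumr.
  by apply: eq_bigr => g _; rewrite /tsum /=; ring.
rewrite (eq_E inner); apply: eq_bigr => f _; rewrite {1}/tsum -!big_split mulr_sumr.
apply: eq_bigr => g _; rewrite -!big_split mulr_sumr; apply: eq_bigr => h _.
by rewrite /heavy3 /tsum /=; ring.
Qed.

(** The expanded count is the sum of [triple_score] with [rho = zeta / s] over three matching edges,
    weighted by [y], so [triple_score_le] bounds it by [s ^+ 3] times the maximum. As
    [#|C| = 3 * s + zeta], this is the right-hand side. *)
Lemma heavy_triples_count :
  (#|[set f : {ffun 'I_3 -> C} | (1 <= \sum_j w (f j))%R]|)%:R <=
  Num.max (27 * s ^+ 3) (#|C|%:R ^+ 3 - (#|C|%:R - s) ^+ 3).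
Proof.
have s0 : 0 <= s by apply: sumr_ge0.
have zeta0 : 0 <= zeta by apply: sumr_ge0 => v _; rewrite subr_ge0.
(* The ratio [rho] needs [s > 0]; for an empty matching every [E g] vanishes. *)
rewrite count3 count_expand; have [sz|sn] := eqVneq s 0.
  have yz f : y f = 0.
    apply/eqP; rewrite eq_le y0 andbT -sz /s (bigD1 f) //= lerDl.
    exact: sumr_ge0.
  have Ez g : E g = 0 by rewrite /E big1 // => f _; rewrite yz mul0r.
  by rewrite !Ez sz !(mulr0, expr0n, addr0) le_max lexx.
have sp : 0 < s by rewrite lt0r sn.
pose rho := zeta / s; have rho0 : 0 <= rho by rewrite divr_ge0.
have zE : zeta = rho * s by rewrite /rho divfK.
have Y3 (F : {ffun 'I_3 -> C} -> {ffun 'I_3 -> C} -> {ffun 'I_3 -> C} -> R) K :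
   (forall f g h, y f != 0 -> y g != 0 -> y h != 0 -> F f g h <= K) ->
   \sum_f \sum_g \sum_h y f * y g * y h * F f g h <= s ^+ 3 * K.
  move=> hF; have -> : s ^+ 3 * K = \sum_f \sum_g \sum_h y f * y g * y h * K.
    rewrite !exprS expr0 mulr1 -!mulrA mulr_suml; apply: eq_bigr => f _.
    rewrite mulr_suml mulr_sumr; apply: eq_bigr => g _.
    by rewrite mulr_suml !mulr_sumr; apply: eq_bigr => h _; rewrite !mulrA.
  apply: ler_sum => f _; apply: ler_sum => g _; apply: ler_sum => h _.
  have [->|yf] := eqVneq (y f) 0; first by rewrite !mul0r.
  have [->|yg] := eqVneq (y g) 0; first by rewrite mulr0 !mul0r.
  have [->|yh] := eqVneq (y h) 0; first by rewrite mulr0 !mul0r.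
  by rewrite ler_wpM2l ?hF // !mulr_ge0.
have bound := Y3 (fun f g h => triple_score rho (wt f) (wt g) (wt h)) _
  (fun f g h yf yg yh => triple_score_le rho0 (unit_wt yf) (unit_wt yg) (unit_wt yh)).
(* Counts on two edges or on one are padded to sums over three edges by factors [s], once for each
   choice of the edges involved. *)
have S2 : s * \sum_f \sum_g y f * y g * heavy2 (wt f) (wt g) =
    \sum_f \sum_g \sum_h y f * y g * y h * heavy2 (wt f) (wt g).
  rewrite mulr_sumr; apply: eq_bigr => f _; rewrite mulr_sumr.
  apply: eq_bigr => g _; rewrite mulr_suml; apply: eq_bigr => h _; ring.
have S2' : s * \sum_f \sum_g y f * y g * heavy2 (wt f) (wt g) =
    \sum_f \sum_g \sum_h y f * y g * y h * heavy2 (wt f) (wt h).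
  rewrite mulr_sumr; apply: eq_bigr => f _; rewrite mulr_sumr exchange_big /=.
  apply: eq_bigr => g _; rewrite mulr_suml; apply: eq_bigr => h _; ring.
have S2'' : s * \sum_f \sum_g y f * y g * heavy2 (wt f) (wt g) =
    \sum_f \sum_g \sum_h y f * y g * y h * heavy2 (wt g) (wt h).
  rewrite mulr_suml; apply: eq_bigr => f _; rewrite mulr_sumr.
  apply: eq_bigr => g _; rewrite mulr_sumr; apply: eq_bigr => h _; ring.
have S1 : s ^+ 2 * \sum_f y f * heavy1 (wt f) =
    \sum_f \sum_g \sum_h y f * y g * y h * heavy1 (wt f).
  rewrite mulr_sumr; apply: eq_bigr => f _; rewrite expr2 -mulrA mulr_suml.
  apply: eq_bigr => g _; rewrite mulr_suml mulr_sumr; apply: eq_bigr => h _; ring.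
have S1' : s ^+ 2 * \sum_f y f * heavy1 (wt f) =
    \sum_f \sum_g \sum_h y f * y g * y h * heavy1 (wt g).
  rewrite S1 exchange_big /=; apply: eq_bigr => f _; apply: eq_bigr => g _.
  by apply: eq_bigr => h _; ring.
have S1'' : s ^+ 2 * \sum_f y f * heavy1 (wt f) =
    \sum_f \sum_g \sum_h y f * y g * y h * heavy1 (wt h).
  rewrite S1'; apply: eq_bigr => f _; rewrite exchange_big /=; apply: eq_bigr => g _.
  by apply: eq_bigr => h _; ring.
have main : \sum_f \sum_g \sum_h y f * y g * y h * triple_score rho (wt f) (wt g) (wt h) =
   E (fun x => E (fun z => E (fun t => heavy (x + z + t)))) +
   3 * zeta * E (fun x => E (fun z => heavy (x + z))) + 3 * zeta ^+ 2 * E heavy.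
  rewrite E3 E2 E1.
  have -> : 3 * zeta * \sum_f \sum_g y f * y g * heavy2 (wt f) (wt g) =
     rho * (s * \sum_f \sum_g y f * y g * heavy2 (wt f) (wt g)) +
     rho * (s * \sum_f \sum_g y f * y g * heavy2 (wt f) (wt g)) +
     rho * (s * \sum_f \sum_g y f * y g * heavy2 (wt f) (wt g)).
    by rewrite zE; ring.
  have -> : 3 * zeta ^+ 2 * \sum_f y f * heavy1 (wt f) =
     rho ^+ 2 * (s ^+ 2 * \sum_f y f * heavy1 (wt f)) +
     rho ^+ 2 * (s ^+ 2 * \sum_f y f * heavy1 (wt f)) +
     rho ^+ 2 * (s ^+ 2 * \sum_f y f * heavy1 (wt f)).
    by rewrite zE; ring.
  rewrite {1}S2 {1}S2' {1}S2'' {1}S1 {1}S1' {1}S1''.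
  rewrite !mulr_sumr -!big_split; apply: eq_bigr => f _.
  rewrite !mulr_sumr -!big_split; apply: eq_bigr => g _.
  rewrite !mulr_sumr -!big_split; apply: eq_bigr => h _.
  by rewrite /triple_score /=; ring.
rewrite -main; apply: le_trans bound _; rewrite maxr_pMr ?exprn_ge0 //.
have -> : s ^+ 3 * (19 + 15 * rho + 3 * rho ^+ 2) =
    19 * s ^+ 3 + 15 * s ^+ 2 * zeta + 3 * s * zeta ^+ 2 by rewrite zE; ring.
by rewrite mulrC zetaE ge_max !le_max; apply/andP; split; apply/orP;
  [left|right]; rewrite le_eqVlt; apply/orP; left; apply/eqP; ring.
Qed.

End HeavyTriples.

(** * Fractional matchings *)

Section FractionalMatching.
Local Open Scope ring_scope.
Variable R : archiRealFieldType.

Section Matching.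
Variables (r : nat) (C : finType).
Implicit Types (E : {set {ffun 'I_r -> C}}) (y : {ffun 'I_r -> C} -> R).

(** Tuples may repeat a vertex; the load counts every occurrence. *)
Definition vertex_load y (v : C) : R := \sum_f y f * \sum_i (f i == v)%:R.

Definition fractional_matching E y :=
  [/\ forall f, 0 <= y f, forall f, y f != 0 -> f \in E &
      forall v, vertex_load y v <= 1].

Let sum_incidence (w : C -> R) (f : {ffun 'I_r -> C}) :
  \sum_v (\sum_i (f i == v)%:R) * w v = \sum_i w (f i).
Proof.
under eq_bigr do rewrite mulr_suml; rewrite exchange_big /=.
apply: eq_bigr => i _; rewrite (bigD1 (f i)) //= eqxx mul1r big1 ?addr0 // => v hv.
by rewrite eq_sym (negPf hv) mul0r.
Qed.

Let sum_load (w : C -> R) y :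
  \sum_v w v * vertex_load y v = \sum_f y f * \sum_i w (f i).
Proof.
under [RHS]eq_bigr do rewrite -sum_incidence mulr_sumr.
rewrite [RHS]exchange_big /=; apply: eq_bigr => v _.
by rewrite mulr_sumr; apply: eq_bigr => f _; rewrite mulrC mulrA.
Qed.

(** LP duality with the indicator of [E] as objective, [y] being cut down to [E]. The duality gap is
    a sum of non-negative terms and at most 0, so all terms vanish: complementary slackness. *)
Lemma optimal_fractional_matching E : (0 < r)%N ->
  exists (w : C -> R) y, [/\ fractional_matching E y, forall v, 0 <= w v,
    (forall f, f \in E -> 1 <= \sum_i w (f i)) /\ \sum_v w v = \sum_f y f,
    forall f, y f != 0 -> \sum_i w (f i) = 1 &
    forall v, w v != 0 -> vertex_load y v = 1].
Proof.
move=> r_gt0; pose A (f : {ffun 'I_r -> C}) v : R := \sum_i (f i == v)%:R.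
have A0 f v : 0 <= A f v by apply: sumr_ge0.
have [|w [y [w0 y0 cov pack obj]]] := @lp_duality R C _ A (fun f => (f \in E)%:R) A0.
  move=> f _; exists (f (Ordinal r_gt0)); rewrite /A (bigD1 (Ordinal r_gt0)) //=.
  by rewrite eqxx ltr_wpDr ?sumr_ge0.
pose y' f := (f \in E)%:R * y f.
have y'0 f : 0 <= y' f by rewrite mulr_ge0.
have y'E f : y' f != 0 -> f \in E by rewrite /y'; case: (f \in E); rewrite ?mul0r ?eqxx.
have load1 v : vertex_load y' v <= 1.
  apply: le_trans (pack v); apply: ler_sum => f _; rewrite mulrC ler_wpM2l ?A0 //.
  by rewrite /y'; case: (f \in E); rewrite ?mul1r ?mul0r.
have cov' f : f \in E -> 1 <= \sum_i w (f i).
  by move=> fE; have := cov f; rewrite fE sum_incidence.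
have gap1 f : 0 <= y' f * (\sum_i w (f i) - 1).
  have [->|/y'E/cov'] := eqVneq (y' f) 0; first by rewrite mul0r.
  by move=> h; rewrite mulr_ge0 // subr_ge0.
have gap2 v : 0 <= w v * (1 - vertex_load y' v) by rewrite mulr_ge0 // subr_ge0.
have gap : \sum_f y' f * (\sum_i w (f i) - 1) + \sum_v w v * (1 - vertex_load y' v) =
    \sum_v w v - \sum_f y' f.
  under eq_bigr do rewrite mulrBr mulr1.
  under [X in _ + X]eq_bigr do rewrite mulrBr mulr1.
  by rewrite !sumrB sum_load; ring.
have g1 : 0 <= \sum_f y' f * (\sum_i w (f i) - 1) by apply: sumr_ge0.
have g2 : 0 <= \sum_v w v * (1 - vertex_load y' v) by apply: sumr_ge0.
have obj' : \sum_v w v <= \sum_f y' f by [].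
exists w, y'; split=> //.
- by split=> //; lra.
- move=> f yf; have : \sum_f y' f * (\sum_i w (f i) - 1) = 0 by lra.
  move/eqP; rewrite psumr_eq0 // => /allP/(_ f); rewrite mem_index_enum => /(_ isT).
  by rewrite mulf_eq0 (negPf yf) subr_eq0 => /eqP.
- move=> v wv; have : \sum_v w v * (1 - vertex_load y' v) = 0 by lra.
  move/eqP; rewrite psumr_eq0 // => /allP/(_ v); rewrite mem_index_enum => /(_ isT).
  by rewrite mulf_eq0 (negPf wv) subr_eq0 => /eqP.
Qed.

(** The small support limits the loss when the matching is later rounded to integers. Loads are
    preserved, and they sum to [r] times the total. *)
Lemma sparse_fractional_matching E y : fractional_matching E y ->
  exists y', [/\ fractional_matching E y',
    r%:R * \sum_f y' f = r%:R * \sum_f y f &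
    (#|[set f | y' f != 0%R]| <= #|C|)%N].
Proof.
case=> y0 yE load1; pose A (f : {ffun 'I_r -> C}) v : R := \sum_i (f i == v)%:R.
have [y' [y'0 y'S y'A y'c]] := caratheodory_cone A y0.
have loadE v : vertex_load y' v = vertex_load y v.
  by have := y'A v; rewrite /vertex_load; under eq_bigr do rewrite mulrC;
     move=> ->; apply: eq_bigr => f _; rewrite mulrC.
have total z : r%:R * \sum_f z f = \sum_v vertex_load z v.
  have := sum_load (fun=> 1) z; under eq_bigr do rewrite mul1r; move=> ->.
  by rewrite mulrC mulr_suml; apply: eq_bigr => f _; rewrite sumr_const card_ord.
exists y'; split=> //; last by rewrite !total; apply: eq_bigr => v _; rewrite loadE.
by split=> // [f h|v]; [apply: yE; apply: contra_neq h => /y'S | rewrite loadE].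
Qed.

End Matching.

Lemma expr_diff_le (a b : R) r : 0 <= a -> a <= b -> b <= 1 ->
  b ^+ r - a ^+ r <= r%:R * (b - a).
Proof.
move=> a0 ab b1; elim: r => [|r IH]; first by rewrite !expr0 mul0r subrr.
have b0 : 0 <= b by apply: le_trans ab.
have ar : 0 <= a ^+ r by apply: exprn_ge0.
have ar1 : a ^+ r <= 1 by apply: exprn_ile1 => //; apply: le_trans b1.
rewrite !exprS -natr1.
have h1 : b * (b ^+ r - a ^+ r) <= 1 * (r%:R * (b - a)).
  have rb : 0 <= r%:R * (b - a) by rewrite mulr_ge0 ?subr_ge0.
  apply: le_trans (_ : b * (r%:R * (b - a)) <= _); first by rewrite ler_wpM2l.
  by rewrite ler_wpM2r.
have h2 : (b - a) * a ^+ r <= (b - a) * 1 by rewrite ler_wpM2l ?subr_ge0.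
lra.
Qed.

(** The limits of [r! / n ^ r] times the numbers of edges of the clique and of the cover
    construction. *)
Definition limit_density (r : nat) (c : R) : R :=
  Num.max (c ^+ r) (1 - (1 - c / r%:R) ^+ r).

Let cover_density_lip r (c d : R) : (0 < r)%N -> 0 <= c -> c <= d -> d <= 1 ->
  1 - (1 - d / r%:R) ^+ r <= 1 - (1 - c / r%:R) ^+ r + (d - c).
Proof.
move=> r0 c0 cd d1; have rR : 0 < r%:R :> R by rewrite ltr0n.
have r1 : 1 <= r%:R :> R by rewrite ler1n.
have := @expr_diff_le (1 - d / r%:R) (1 - c / r%:R) r.
have -> : r%:R * (1 - c / r%:R - (1 - d / r%:R)) = d - c by field; rewrite gt_eqF.
move=> H; suff : (1 - c / r%:R) ^+ r - (1 - d / r%:R) ^+ r <= d - c by lra.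
apply: H; first by rewrite subr_ge0 ler_pdivrMr //; lra.
  by rewrite lerB // ler_pM2r ?invr_gt0.
by rewrite gerBl divr_ge0 // ltW.
Qed.

(** If the optimum is too small, the dual weights have total below [c' * #|C| / r] and make every
    tuple of [E] heavy, so the counts of heavy tuples contradict the density of [E]. The excess of
    [c'] over [c] moves these counts by at most [eps] in density. *)
Theorem large_fractional_matching (r : nat) (c eps : R) : (3 <= r)%N -> 0 < c ->
  (r = 3%N -> c < 1) -> ((4 <= r)%N -> c < 1 / 2) -> 0 < eps ->
  exists2 c', c < c' & exists N0, forall C : finType, (N0 <= #|C|)%N ->
    forall E : {set {ffun 'I_r -> C}},
    (limit_density r c + eps) * #|C|%:R ^+ r < #|E|%:R ->
    exists2 y, fractional_matching E y & c' * #|C|%:R <= r%:R * \sum_f y f.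
Proof.
move=> r3 c0 hc3 hc4 eps0; have r0 : (0 < r)%N by apply: leq_trans r3.
have rR : 0 < r%:R :> R by rewrite ltr0n.
have [r_eq|r4] : r = 3%N \/ (4 <= r)%N.
  by move: r3; rewrite leq_eqVlt => /predU1P[<-|]; [left|right].
- subst r; have c1 := hc3 erefl.
  (* The first term keeps [c'] below 1; the second answers the Lipschitz constant 3 of the cube on
     the unit interval. *)
  pose c' := c + Num.min ((1 - c) / 2) (eps / 3).
  have m0 : 0 < Num.min ((1 - c) / 2) (eps / 3) by rewrite lt_min; apply/andP; split; lra.
  have m1 : Num.min ((1 - c) / 2) (eps / 3) <= (1 - c) / 2 by rewrite ge_min lexx.
  have m2 : Num.min ((1 - c) / 2) (eps / 3) <= eps / 3 by rewrite ge_min lexx orbT.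
  exists c'; first by rewrite /c'; lra.
  exists 0%N => C _ E hE.
  have [w [y [my w0 [cov sumw] yt wt]]] := optimal_fractional_matching E r0.
  exists y => //; rewrite leNgt; apply/negP => hs.
  move: hE; apply/negP; rewrite -leNgt.
  set N : R := #|C|%:R in hs *; have N0 : 0 <= N by [].
  set s := \sum_f y f in hs sumw.
  have s0 : 0 <= s by apply: sumr_ge0; case: my.
  apply: le_trans (_ : (#|[set f : {ffun 'I_3 -> C} | (1 <= \sum_j w (f j))%R]|)%:R <= _).
    by rewrite ler_nat; apply/subset_leq_card/subsetP => f fE; rewrite inE cov.
  case: (my) => y0 _ load1.
  apply: le_trans (heavy_triples_count w0 y0 load1 yt wt) _.
  rewrite -/s -/N; set d := c' in hs *.
  have d1 : d <= 1 by rewrite /d /c'; lra.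
  have cd : c <= d by rewrite /d /c'; lra.
  have de : d - c <= eps / 3 by rewrite /d /c'; lra.
  have clip := cover_density_lip r0 (ltW c0) cd d1.
  have plip := @expr_diff_le c d 3 (ltW c0) cd d1.
  have l1 : c ^+ 3 <= limit_density 3 c by rewrite le_max lexx.
  have l2 : 1 - (1 - c / 3%:R) ^+ 3 <= limit_density 3 c by rewrite le_max lexx orbT.
  have N3 : 0 <= N ^+ 3 by apply: exprn_ge0.
  rewrite ge_max; apply/andP; split.
    apply: le_trans (_ : d ^+ 3 * N ^+ 3 <= _).
      rewrite -exprMn (_ : 27 * s ^+ 3 = (3 * s) ^+ 3); last by ring.
      apply: lerXn2r; rewrite ?nnegrE ?mulr_ge0 //; lra.
    by rewrite ler_wpM2r //; lra.
  apply: le_trans (_ : (1 - (1 - d / 3) ^+ 3) * N ^+ 3 <= _).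
    rewrite mulrBl mul1r lerB // -exprMn.
    apply: lerXn2r; rewrite ?nnegrE ?mulr_ge0 //; nra.
  by rewrite ler_wpM2r //; lra.
have c12 := hc4 r4; case: r r3 hc3 hc4 r0 rR r4 => [|[|m]] // r3 _ _ r0 rR r4.
(* One [dl] pays for [c'], a second one for rounding the cover weight up to the integer [k];
   [c + 2 * dl] stays at most 1/2. *)
pose dl := Num.min ((1 / 2 - c) / 2) (eps / 2).
have dl0 : 0 < dl by rewrite lt_min; apply/andP; split; lra.
have dl1 : dl <= (1 / 2 - c) / 2 by rewrite ge_min lexx.
have dl2 : dl <= eps / 2 by rewrite ge_min lexx orbT.
exists (c + dl); first by lra.
have [N0 HN0] := large_nat m.+2%:R dl0.
exists N0 => C /HN0 hN E hE.
have [w [y [my w0 [cov sumw] yt wt]]] := optimal_fractional_matching E r0.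
exists y => //; rewrite leNgt; apply/negP => hs.
move: hE; apply/negP; rewrite -leNgt.
set N : R := #|C|%:R in hN hs *; have NN : 0 <= N by [].
set s := \sum_f y f in hs sumw.
have s0 : 0 <= s by apply: sumr_ge0; case: my.
apply: le_trans (_ : (#|[set f : {ffun 'I_m.+2 -> C} | (1 <= \sum_j w (f j))%R]|)%:R <= _).
  by rewrite ler_nat; apply/subset_leq_card/subsetP => f fE; rewrite inE cov.
pose k := (Num.truncn s).+1.
have sk : s <= k%:R by apply/ltW/truncnS_gt.
have ks : k%:R <= s + 1 by rewrite -natr1 lerD2r truncn_le.
pose d := c + 2 * dl.
have kd : m.+2%:R * k%:R <= d * N.
  apply: le_trans (_ : m.+2%:R * (s + 1) <= _); first by rewrite ler_wpM2l // ltW.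
  rewrite /d; lra.
have d12 : d <= 1 / 2 by rewrite /d; lra.
(* Here [c < 1 / 2] enters: [d <= 1 / 2] gives [2 * r * k <= #|C|]. *)
have hk : ((2 * m.+1 + 1) * k <= #|C|)%N.
  rewrite -(ler_nat R) natrM natrD natrM -/N.
  have mE : m.+2%:R = m.+1%:R + 1 :> R by rewrite -natr1.
  have k0 : 0 <= k%:R :> R by [].
  have := ler_wpM2r NN d12; rewrite mE in kd; lra.
have wk : \sum_v w v <= k%:R by rewrite sumw.
apply: le_trans (heavy_count w0 wk hk) _; rewrite -/N.
have d1 : d <= 1 by lra.
have cd : c <= d by rewrite /d; lra.
have clip := cover_density_lip r0 (ltW c0) cd d1.
have l2 : 1 - (1 - c / m.+2%:R) ^+ m.+2 <= limit_density m.+2 c by rewrite le_max lexx orbT.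
apply: le_trans (_ : (1 - (1 - d / m.+2%:R) ^+ m.+2) * N ^+ m.+2 <= _).
  rewrite mulrBl mul1r lerB // -exprMn.
  have dr : d / m.+2%:R <= 1.
    by rewrite ler_pdivrMr // mul1r; apply: le_trans d1 _; rewrite ler1n.
  have kN : k%:R <= d / m.+2%:R * N.
    by rewrite mulrAC ler_pdivlMr // mulrC.
  apply: lerXn2r; rewrite ?nnegrE; last by move: kN; move: (d / _) => x; lra.
    by rewrite mulr_ge0 // subr_ge0.
  by have := ler_wpM2r NN dr; move: kN; move: (d / _) => x; lra.
rewrite ler_wpM2r ?exprn_ge0 //; rewrite /d in clip *; lra.
Qed.

End FractionalMatching.

(** * Tilings by complete r-partite r-graphs *)

Lemma uniq_map_inj (S T : eqType) (f : S -> T) (s : seq S) :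
  uniq (map f s) -> {in s &, injective f}.
Proof.
elim: s => [|a s IH] //= /andP[fa us] x y.
rewrite !inE => /predU1P[->|xs] /predU1P[->|ys] // e.
- by rewrite e map_f in fa.
- by rewrite -e map_f in fa.
- exact: IH.
Qed.

Lemma divn_pair_inj t p k p' k' : (k < t)%N -> (k' < t)%N ->
  (p * t + k = p' * t + k')%N -> p = p' /\ k = k'.
Proof.
move=> kt kt' e; have t0 : (0 < t)%N by apply: leq_ltn_trans kt.
have := congr1 (divn^~ t) e; rewrite !divnMDl // !divn_small // !addn0 => ep.
by split=> //; move: e; rewrite ep => /addnI.
Qed.

Section Tilings.
Local Open Scope ring_scope.
Variables (V : finType) (r : nat).

Section TileSize.
Variable t : nat.
Notation tile := {ffun 'I_r * 'I_t -> V}.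
Implicit Types (H : {set {set V}}) (g : tile) (ts : seq tile).

Definition tile_in H g : bool :=
  [forall p : {ffun 'I_r -> 'I_t}, [set g (i, p i) | i : 'I_r] \in H].

Definition tile_vertices ts : seq V := flatten [seq codom g | g : tile <- ts].

(** One [uniq] on the concatenated vertex lists makes each tile injective and the tiles disjoint. *)
Definition tiling H ts : bool := all (tile_in H) ts && uniq (tile_vertices ts).

Lemma size_tile_vertices ts : size (tile_vertices ts) = (size ts * (r * t))%N.
Proof.
elim: ts => [|g ts IH] //=; rewrite /tile_vertices /= size_cat IH size_codom.
by rewrite card_prod !card_ord mulSn.
Qed.

Lemma tile_vertices_cat ts1 ts2 :
  tile_vertices (ts1 ++ ts2) = tile_vertices ts1 ++ tile_vertices ts2.
Proof. by rewrite /tile_vertices map_cat flatten_cat. Qed.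

Lemma tiling_cat H ts1 ts2 : tiling H ts1 -> tiling H ts2 ->
  {in tile_vertices ts1, forall x, x \notin tile_vertices ts2} ->
  tiling H (ts1 ++ ts2).
Proof.
move=> /andP[a1 u1] /andP[a2 u2] d; rewrite /tiling all_cat a1 a2 /=.
rewrite tile_vertices_cat cat_uniq u1 u2 andbT /=; apply/hasPn=> x x2.
by apply/negP=> /d; rewrite x2.
Qed.

Lemma tile_vertices_map (I : finType) (F : I -> tile) :
  tile_vertices [seq F j | j <- enum I] =
  [seq (F p.1 p.2) | p <- [seq (j, x) | j <- enum I, x <- enum {: 'I_r * 'I_t}]].
Proof.
rewrite /tile_vertices map_flatten; congr flatten; elim: (enum I) => //= j s ->.
by congr (_ :: _); rewrite -map_comp codomE.
Qed.

Lemma uniq_tile_vertices_map (I : finType) (F : I -> tile) :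
  injective (fun p : I * ('I_r * 'I_t) => F p.1 p.2) ->
  uniq (tile_vertices [seq F j | j <- enum I]).
Proof.
move=> injF; rewrite tile_vertices_map map_inj_uniq //.
by rewrite allpairs_uniq ?enum_uniq // => -[x1 x2] [y1 y2].
Qed.

Lemma tile_vertices_inj ts : uniq (tile_vertices ts) ->
  injective (fun p : 'I_(size ts) * ('I_r * 'I_t) => tnth (in_tuple ts) p.1 p.2).
Proof.
move=> u x y; have e : ts = [seq tnth (in_tuple ts) j | j <- enum 'I_(size ts)].
  by rewrite map_tnth_enum.
have mem p : p \in [seq (j, x) | j <- enum 'I_(size ts), x <- enum {: 'I_r * 'I_t}].
  by case: p => j z; apply: allpairs_f; rewrite mem_enum.
by move: u; rewrite {1}e tile_vertices_map => /uniq_map_inj H; apply: H.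
Qed.

End TileSize.

(** In every part the positions outside [U] are listed and cut into blocks of length [t']; the
    [p]-th new tile takes the [p]-th block of each part. *)
Lemma cut_tile (t t' m : nat) (H : {set {set V}}) (g : {ffun 'I_r * 'I_t -> V})
    (U : {pred V}) :
  (0 < t)%N -> tile_in H g -> injective g ->
  (forall i, m * t' <= #|[set k | g (i, k) \notin U]|)%N ->
  exists ts : seq {ffun 'I_r * 'I_t' -> V}, [/\ tiling H ts, size ts = m &
    {in tile_vertices ts, forall x, x \in codom g /\ x \notin U}].
Proof.
move=> t0 gH injg hU; pose A i := enum [set k | g (i, k) \notin U].
pose pos (p : 'I_m) i (k : 'I_t') := nth (Ordinal t0) (A i) (p * t' + k).
have posA (p : 'I_m) i (k : 'I_t') : (p * t' + k < size (A i))%N.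
  rewrite -cardE; apply: leq_trans (hU i); apply: leq_trans (_ : p.+1 * t' <= _)%N.
    by rewrite mulSnr ltn_add2l.
  by rewrite leq_mul2r ltn_ord orbT.
pose F p : {ffun 'I_r * 'I_t' -> V} := [ffun x => g (x.1, pos p x.1 x.2)].
exists [seq F p | p <- enum 'I_m]; split; last 1 first.
- move=> x /flattenP[s /mapP[f /mapP[p _ ->] ->] /codomP[[i k] ->]].
  rewrite ffunE codom_f; split=> //.
  by have := mem_nth (Ordinal t0) (posA p i k); rewrite mem_enum inE.
- apply/andP; split.
    apply/allP=> f /mapP[p _ ->]; apply/forallP=> b.
    have /forallP/(_ [ffun i => pos p i (b i)]) := gH; congr (_ \in H).
    by apply: eq_imset => i; rewrite !ffunE.
  apply: uniq_tile_vertices_map => -[p [i k]] [p' [i' k']] /=.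
  rewrite !ffunE => /injg[ei]; subst i' => /eqP; rewrite nth_uniq ?enum_uniq //.
  by move/eqP/divn_pair_inj; case=> // /val_inj-> /val_inj->.
- by rewrite size_map size_enum_ord.
Qed.

Lemma cut_tiling (t t' m : nat) (H : {set {set V}}) (ts : seq {ffun 'I_r * 'I_t -> V})
    (U : {pred V}) :
  (0 < t)%N -> tiling H ts ->
  (forall g i, g \in ts -> m * t' <= #|[set k | g (i, k) \notin U]|)%N ->
  exists ts' : seq {ffun 'I_r * 'I_t' -> V}, [/\ tiling H ts', size ts' = (m * size ts)%N &
    {in tile_vertices ts', forall x, x \in tile_vertices ts /\ x \notin U}].
Proof.
move=> t0; elim: ts => [|g ts IH] /=.
  by move=> _ _; exists [::]; rewrite muln0; split.
have tvE : tile_vertices (g :: ts) = codom g ++ tile_vertices ts by [].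
case/andP=> /= /andP[gH tsH]; rewrite tvE cat_uniq => /and3P[ug disj uts] hU.
have [|g' i g'ts|ts1 [til1 size1 sub1]] := IH.
- by apply/andP.
- by apply: hU; rewrite inE g'ts orbT.
have injg : injective g by apply/injectiveP.
have [|ts2 [til2 size2 sub2]] := cut_tile t0 gH injg (U := U) (t' := t') (m := m).
  by move=> i; apply: hU; rewrite mem_head.
exists (ts2 ++ ts1); split.
- apply: tiling_cat => // x /sub2[xg _]; apply/negP => /sub1[xts _].
  by move/hasPn: disj => /(_ x xts); rewrite /= xg.
- by rewrite size_cat size1 size2 mulnS.
- move=> x; rewrite tile_vertices_cat !mem_cat => /orP[/sub2[-> ->]//|/sub1[h ->]].
  by rewrite h orbT.
Qed.

(** Clusters are the parts of the tiles and blocks of [t] among the other vertices, with fewer than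
    [t] left over. As they refine the tiles, a bound on the used vertices of a cluster also holds
    for a part of a tile. *)
Lemma cluster_partition (t : nat) (ts : seq {ffun 'I_r * 'I_t -> V}) :
  (0 < t)%N -> uniq (tile_vertices ts) ->
  exists (C : finType) (h : C * 'I_t -> V), [/\ injective h,
    (#|V| < #|C| * t + t)%N &
    forall g i, g \in ts -> exists v, forall k, h (v, k) = g (i, k)].
Proof.
move=> t0 u; pose rest := enum [predC tile_vertices ts].
pose q := size ts; pose m := (size rest %/ t)%N.
have rest_lt (a : 'I_m) (k : 'I_t) : (a * t + k < size rest)%N.
  apply: leq_trans (leq_trunc_div (size rest) t); rewrite -/m.
  apply: leq_trans (_ : a.+1 * t <= _)%N; first by rewrite mulSnr ltn_add2l.
  by rewrite leq_mul2r ltn_ord orbT.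
have [v0 rest0] : exists f : 'I_m -> 'I_t -> V,
    (forall a k, f a k \in rest) /\
    (forall a k a' k', f a k = f a' k' -> a = a' /\ k = k').
  exists (fun a k => tnth (in_tuple rest) (Ordinal (rest_lt a k))); split.
    by move=> a k; rewrite mem_tnth.
  move=> a k a' k' /eqP.
  have x0 : V by exact: tnth (in_tuple rest) (Ordinal (rest_lt a k)).
  rewrite !(tnth_nth x0).
  rewrite /= nth_uniq ?enum_uniq //.
  by move/eqP/divn_pair_inj; case=> // /val_inj-> /val_inj->.
case: rest0 => v0_in v0_inj.
exists ('I_q * 'I_r + 'I_m)%type.
pose h (x : ('I_q * 'I_r + 'I_m) * 'I_t) : V := match x.1 with
  | inl ji => tnth (in_tuple ts) ji.1 (ji.2, x.2)
  | inr a => v0 a x.2 end.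
have in_ts j i k : tnth (in_tuple ts) j (i, k) \in tile_vertices ts.
  apply/flattenP; exists (codom (tnth (in_tuple ts) j)); last exact: codom_f.
  by apply: map_f; apply: mem_tnth.
have notin a k : v0 a k \notin tile_vertices ts.
  by have := v0_in a k; rewrite mem_enum.
exists h; split.
- move=> [[[j i]|a] k] [[[j' i']|a'] k']; rewrite /h /=.
  + move=> e; have := tile_vertices_inj u (x1 := (j, (i, k))) (x2 := (j', (i', k'))) e.
    by case=> -> -> ->.
  + by move=> e; have := notin a' k'; rewrite -e in_ts.
  + by move=> e; have := notin a k; rewrite e in_ts.
  + by case/v0_inj=> -> ->.
- rewrite card_sum card_prod !card_ord mulnDl.
  have -> : #|V| = (size (tile_vertices ts) + size rest)%N.
    rewrite -(cardC (mem (tile_vertices ts))) -cardE; congr (_ + _)%N.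
    exact/card_uniqP.
  rewrite size_tile_vertices -/q -addnA mulnA ltn_add2l.
  by rewrite {1}(divn_eq (size rest) t) ltn_add2l ltn_mod.
- move=> g i /(nthP g)[j jq <-]; exists (inl (Ordinal jq, i)) => k.
  by rewrite /h /= (tnth_nth g).
Qed.

End Tilings.

(** * Reduced r-graph of the clusters and greedy extraction of tiles *)

Section Clusters.
Local Open Scope ring_scope.
Variables (V : finType) (r' : nat) (H : {set {set V}}).
Local Notation r := r'.+1.
Hypothesis rH : is_rgraph r H.
Variables (C : finType) (t : nat) (h : C * 'I_t -> V).
Hypothesis h_inj : injective h.

Definition cluster_edges (f : {ffun 'I_r -> C}) : {set {ffun 'I_r -> 'I_t}} :=
  [set p : {ffun 'I_r -> 'I_t} | [set h (f i, p i) | i : 'I_r] \in H].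

Lemma edge_inj (x : 'I_r -> V) : [set x i | i : 'I_r] \in H -> injective x.
Proof.
move=> xH; have /forallP/(_ [set x i | i : 'I_r])/implyP/(_ xH)/eqP e := rH.
have /imset_injP inj : #|[set x i | i : 'I_r]| == #|'I_r| by rewrite e card_ord.
by move=> i j; apply: inj.
Qed.

Let card_edge_ordered e : e \in H ->
  (r`! <= #|[set x : {ffun 'I_r -> V} | [set x i | i : 'I_r] == e]|)%N.
Proof.
move=> eH; have /forallP/(_ e)/implyP/(_ eH)/eqP ce := rH.
have -> : r`! = #|[set x : {ffun 'I_r -> V} in ffun_on (mem e) | injectiveb x]|.
  by rewrite card_inj_ffuns_on ce card_ord ffactnn.
apply/subset_leq_card/subsetP => x; rewrite !inE => /andP[/ffun_onP xe /injectiveP inj].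
rewrite eqEcard; apply/andP; split.
  by apply/subsetP=> v /imsetP[i _ ->]; apply: xe.
by rewrite ce card_imset // card_ord.
Qed.

(** Every edge has [r!] orderings. One with all its vertices in clusters is a transversal of a tuple
    of clusters; any other has an entry among the at most [t] vertices left over. *)
Lemma reduced_edges : (#|V| <= #|C| * t + t)%N ->
  (r`! * #|H| <= \sum_f #|cluster_edges f| + r * (t * #|V| ^ r'))%N.
Proof.
move=> hV; pose im (x : {ffun 'I_r -> V}) := [set x i | i : 'I_r].
pose rg : {set V} := h @: setT.
have crg : #|rg| = (#|C| * t)%N.
  by rewrite card_imset // cardsT card_prod card_ord.
have step1 : (r`! * #|H| <= \sum_x (im x \in H))%N.
  have -> : (\sum_x (im x \in H) = \sum_(e in H) #|[set x | im x == e]|)%N.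
    under [RHS]eq_bigr => e _ do rewrite -sum1dep_card big_mkcond.
    rewrite exchange_big; apply: eq_bigr => x _ /=.
    rewrite -big_mkcondr /=; case: (boolP (im x \in H)) => xH.
      rewrite (big_pred1 (im x)) // => e /=; rewrite [RHS]eq_sym.
      by case: eqP => [<-|_]; rewrite ?xH ?andbF.
    by rewrite big_pred0 // => e; apply/andP=> -[eH /eqP xe]; rewrite xe eH in xH.
  by rewrite mulnC -sum_nat_const; apply: leq_sum => e; apply: card_edge_ordered.
apply: leq_trans step1 _.
pose inr_ (x : {ffun 'I_r -> V}) := [forall i, x i \in rg].
have step2 x : (im x \in H <= (inr_ x && (im x \in H)) + \sum_i (x i \notin rg))%N.
  case: (im x \in H) => //; case: (boolP (inr_ x)) => //=.
  rewrite negb_forall => /existsP[i hi]; rewrite (bigD1 i) //= hi.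
  by rewrite addnA leq_addr.
apply: leq_trans (_ : \sum_x ((inr_ x && (im x \in H)) + \sum_i (x i \notin rg)) <= _)%N.
  by apply: leq_sum.
rewrite big_split /= leq_add //; last first.
  rewrite exchange_big /= -[X in (X * _)%N](card_ord r) -sum_nat_const.
  apply: leq_sum => i _; have := card_coord_in i (mem (~: rg)).
  rewrite -sum1dep_card big_mkcond /= => e.
  rewrite (_ : (\sum_(x : {ffun 'I_r -> V}) (x i \notin rg) = #|~: rg| * #|V| ^ r')%N); last first.
    by rewrite -e; apply: eq_bigr => x _; rewrite inE; case: (_ \notin _).
  rewrite leq_mul2r; apply/orP; right; rewrite cardsCs setCK crg; lia.
pose S := [set fp : {ffun 'I_r -> C} * {ffun 'I_r -> 'I_t} | fp.2 \in cluster_edges fp.1].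
have -> : (\sum_f #|cluster_edges f| = #|S|)%N.
  under eq_bigr => f _ do rewrite -sum1_card big_mkcond.
  by rewrite pair_bigA /S -sum1dep_card [RHS]big_mkcond.
pose glue (fp : {ffun 'I_r -> C} * {ffun 'I_r -> 'I_t}) : {ffun 'I_r -> V} :=
  [ffun i => h (fp.1 i, fp.2 i)].
apply: leq_trans (leq_imset_card glue S).
rewrite -big_mkcond sum1dep_card; apply/subset_leq_card/subsetP => x.
rewrite inE => /andP[/forallP xr xH].
have pre i : {z | h z = x i}.
  by apply/sig_eqW; case/imsetP: (xr i) => z _ ->; exists z.
apply/imsetP; exists ([ffun i => (sval (pre i)).1], [ffun i => (sval (pre i)).2]).
  rewrite !inE /=; move: xH; congr (_ \in H); apply: eq_imset => i.
  by rewrite !ffunE -surjective_pairing (svalP (pre i)).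
by apply/ffunP=> i; rewrite !ffunE /= -surjective_pairing (svalP (pre i)).
Qed.

Definition list_load (L : seq {ffun 'I_r -> C}) v : nat :=
  (\sum_(f <- L) \sum_i (f i == v))%N.

Section Greedy.
Variables (R : archiRealFieldType) (t' : nat) (eps : R) (M : nat).
Hypothesis tM : r%:R * (M * t')%:R <= eps / 2 * t%:R.
Hypothesis KST : forall E : {set {ffun 'I_r -> 'I_t}},
  eps / 2 * t%:R ^+ r <= #|E|%:R ->
  exists b : 'I_r -> 'I_t' -> 'I_t, (forall i, injective (b i)) /\
    forall p : {ffun 'I_r -> 'I_t'}, [ffun i => b i (p i)] \in E.

(** Tuples are treated one by one. Earlier tiles use at most [M * t'] vertices of a cluster, which
    by [tM] spoils at most [eps / 2 * t ^ r] transversals; [KST] finds a tile among the others. *)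
Lemma greedy_tiling (L : seq {ffun 'I_r -> C}) :
  (forall f, f \in L -> eps * t%:R ^+ r <= #|cluster_edges f|%:R) ->
  (forall v, list_load L v <= M)%N ->
  exists ts : seq {ffun 'I_r * 'I_t' -> V}, [/\ tiling H ts, size ts = size L &
    forall v, (#|[set k | h (v, k) \in tile_vertices ts]| <= t' * list_load L v)%N].
Proof.
elim: L => [|f L IH] dense load.
  exists [::]; split=> // v; rewrite /list_load big_nil muln0 leqn0 cards_eq0; apply/eqP/setP=> k.
  by rewrite !inE.
have loadS v : list_load (f :: L) v = (\sum_i (f i == v) + list_load L v)%N.
  by rewrite /list_load big_cons.
have [|v|ts [tsH sts used]] := IH.
- by move=> g gL; apply: dense; rewrite inE gL orbT.
- by apply: leq_trans (load v); rewrite loadS leq_addl.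
pose U v := [set k | h (v, k) \in tile_vertices ts].
have cU v : (#|U v| <= M * t')%N.
  apply: leq_trans (used v) _; rewrite mulnC leq_mul2r; apply/orP; right.
  by apply: leq_trans (load v); rewrite loadS leq_addl.
pose E := [set p in cluster_edges f | [forall i, p i \notin U (f i)]].
have cE : (#|cluster_edges f| <= #|E| + r * (M * t' * t ^ r'))%N.
  rewrite -sum1_card big_mkcond /=.
  have -> : #|E| = (\sum_p ((p \in cluster_edges f) && [forall i, p i \notin U (f i)]))%N.
    by rewrite -sum1dep_card big_mkcond; apply: eq_bigr => p _; case: (_ && _).
  apply: leq_trans (_ : \sum_(p : {ffun 'I_r -> 'I_t}) (((p \in cluster_edges f) &&
    [forall i, p i \notin U (f i)]) + \sum_i (p i \in U (f i))) <= _)%N.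
    apply: leq_sum => p _; case: (p \in cluster_edges f) => //=.
    case: (boolP [forall i, p i \notin U (f i)]) => //=.
    rewrite negb_forall => /existsP[i]; rewrite negbK => hi.
    by rewrite (bigD1 i) //= hi.
  rewrite big_split /= leq_add2l exchange_big /=.
  rewrite -[X in (X * _)%N](card_ord r) -sum_nat_const; apply: leq_sum => i _.
  have := card_coord_in i (mem (U (f i))); rewrite -sum1dep_card big_mkcond /= => e.
  rewrite (_ : (\sum_(p : {ffun 'I_r -> 'I_t}) (p i \in U (f i)) = #|U (f i)| * t ^ r')%N).
    by rewrite leq_mul2r cU orbT.
  by move: e; rewrite card_ord => <-; apply: eq_bigr => p _; case: (_ \in _).
have [|b [b_inj bE]] := KST (E := E).
  have := dense f (mem_head _ _) => d.
  have tr : 0 <= t%:R ^+ r' :> R by apply: exprn_ge0.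
  have := ler_wpM2r tr tM; rewrite exprS in d *.
  have : #|cluster_edges f|%:R <= #|E|%:R + r%:R * (M * t')%:R * t%:R ^+ r' :> R.
    by rewrite -natrX -!natrM -natrD ler_nat -mulnA.
  lra.
pose g : {ffun 'I_r * 'I_t' -> V} := [ffun x => h (f x.1, b x.1 x.2)].
have gE (p : {ffun 'I_r -> 'I_t'}) : [set g (i, p i) | i : 'I_r] \in H.
  have := bE p; rewrite inE => /andP[+ _]; rewrite inE; congr (_ \in H).
  by apply: eq_imset => i; rewrite !ffunE.
have gU i k : g (i, k) \notin tile_vertices ts.
  have := bE [ffun => k]; rewrite inE => /andP[_ /forallP/(_ i)].
  by rewrite !ffunE inE.
(* Two parts may lie in the same cluster. Their vertices still differ, since they belong to a common
   edge, which has [r] vertices. *)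
have g_inj : injective g.
  move=> [i k] [j l]; have [<-|ij] := eqVneq i j.
    by rewrite !ffunE => /h_inj[/b_inj->].
  move=> e; have := edge_inj (gE [ffun m => if m == i then k else l]) (x1 := i) (x2 := j).
  rewrite !ffunE eqxx [j == i]eq_sym (negPf ij) => /(_ _) ei.
  by move: ij; rewrite ei ?eqxx //; rewrite !ffunE /= in e.
have tvE : tile_vertices (g :: ts) = codom g ++ tile_vertices ts by [].
exists (g :: ts); split; last 1 first.
- move=> v; rewrite loadS mulnDr tvE.
  apply: leq_trans (_ : #|[set k | h (v, k) \in codom g] :|: U v| <= _)%N.
    by apply/subset_leq_card/subsetP=> k; rewrite !inE mem_cat.
  apply: leq_trans (leq_card_setU _ _) _; apply: leq_add; last exact: used.
  pose Q := [set x : 'I_r * 'I_t' | f x.1 == v].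
  apply: leq_trans (_ : #|[set b x.1 x.2 | x in Q]| <= _)%N.
    apply/subset_leq_card/subsetP=> k; rewrite inE => /codomP[[i l]].
    rewrite ffunE => /h_inj[ev ->]; apply/imsetP; exists (i, l) => //.
    by rewrite inE /= ev.
  apply: leq_trans (leq_imset_card _ _) _.
  have -> : #|Q| = (\sum_(i < r) \sum_(l < t') (f i == v))%N.
    rewrite pair_bigA -sum1dep_card big_mkcond; apply: eq_bigr => x _ /=.
    by case: (_ == _).
  by rewrite big_distrr /=; apply: leq_sum => i _; rewrite sum_nat_const card_ord.
- apply/andP; split=> /=.
    by case/andP: tsH => -> _; rewrite andbT; apply/forallP.
  rewrite tvE cat_uniq; case/andP: tsH => _ ->; rewrite andbT; apply/andP; split.
    exact/injectiveP.
  by apply/hasPn=> x xts; apply/negP=> /codomP[[i k] xe]; have := gU i k; rewrite -xe xts.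
- by rewrite /= sts.
Qed.

End Greedy.
End Clusters.

(** * Raising the covered proportion step by step *)

Section Improvement.
Local Open Scope ring_scope.
Variables (R : archiRealFieldType) (r' : nat).
Local Notation r := r'.+1.

(** [D] is a density normalised by [r!] and [al] a covered proportion. All tile sizes are demanded
    because an improvement step starts from larger tiles than it produces. *)
Definition has_tilings (D al : R) : Prop :=
  forall t, (0 < t)%N -> exists n0, forall V : finType, (n0 <= #|V|)%N ->
  forall H : {set {set V}}, is_rgraph r H -> D * #|V|%:R ^+ r <= (r`! * #|H|)%:R ->
  exists ts : seq {ffun 'I_r * 'I_t -> V}, tiling H ts /\
    al * #|V|%:R <= (size ts * (r * t))%:R.

(** A sparse matching scaled by [M] is rounded down; this loses less than one tuple per element of
    the support, hence at most [#|C|] tuples. *)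
Lemma matching_multiset (C : finType) (E : {set {ffun 'I_r -> C}})
    (y : {ffun 'I_r -> C} -> R) (M : nat) : fractional_matching E y ->
  exists L : seq {ffun 'I_r -> C}, [/\ {subset L <= E},
    forall v, (list_load L v <= M)%N &
    M%:R * (r%:R * \sum_f y f) - r%:R * #|C|%:R <= r%:R * (size L)%:R].
Proof.
case/sparse_fractional_matching => z [[z0 zE z1] <- zc].
pose m f := Num.truncn (M%:R * z f).
have Mz f : 0 <= M%:R * z f by rewrite mulr_ge0.
have sumL (X : {ffun 'I_r -> C} -> nat) :
    (\sum_(f <- flatten [seq nseq (m f) f | f <- index_enum _]) X f = \sum_f m f * X f)%N.
  rewrite big_flatten big_map; apply: eq_bigr => f _.
  by rewrite big_nseq iter_addn_0 mulnC.
exists (flatten [seq nseq (m f) f | f <- index_enum _]); split.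
- move=> f /flattenP[s /mapP[g _ ->]]; rewrite mem_nseq => /andP[mg /eqP->].
  by apply: zE; apply: contraTN mg => /eqP e; rewrite /m e mulr0 truncn0.
- move=> v; rewrite /list_load sumL -(ler_nat R) natr_sum.
  apply: le_trans (_ : \sum_f M%:R * (z f * \sum_i (f i == v)%:R) <= _).
    apply: ler_sum => f _; rewrite natrM natr_sum mulrA.
    by apply: ler_wpM2r; [exact: sumr_ge0 | rewrite /m truncn_le].
  by rewrite -mulr_sumr -[leRHS]mulr1 ler_wpM2l //; apply: z1.
- rewrite mulrCA -mulrBr ler_wpM2l //.
  have -> : size (flatten [seq nseq (m f) f | f <- index_enum _]) = (\sum_f m f)%N.
    by rewrite -sum1_size sumL; under eq_bigr do rewrite muln1.
  rewrite natr_sum lerBlDr mulr_sumr.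
  apply: le_trans (_ : \sum_f ((m f)%:R + (z f != 0%R)%:R) <= _).
    apply: ler_sum => f _; have [->|zf] := eqVneq (z f) 0.
      by rewrite mulr0 addr0.
    by rewrite natr1; apply/ltW/truncnS_gt.
  rewrite big_split /= lerD2l -natr_sum ler_nat; apply: leq_trans zc.
  rewrite -sum1dep_card [leqRHS]big_mkcond /=; apply: leq_sum => f _.
  by case: (_ != _).
Qed.

(** New tiles get a share [1 / K] of the clusters and cover nearly the proportion [c'] of it, while
    old tiles keep the share [K' / K]. As [al <= c < c'], the gain [ga / K] does not depend on
    [al]. *)
Lemma tilings_step (c c' D D' : R) : 0 < c -> c < c' -> 0 <= D' -> D' < D ->
  (exists N0, forall C : finType, (N0 <= #|C|)%N -> forall E : {set {ffun 'I_r -> C}},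
    D' * #|C|%:R ^+ r < #|E|%:R ->
    exists2 y, fractional_matching E y & c' * #|C|%:R <= r%:R * \sum_f y f) ->
  exists2 dl, 0 < dl & forall al, 0 <= al -> al <= c ->
    has_tilings D al -> has_tilings D (al + dl).
Proof.
move=> c0 cc' D'0 DD' [N0 matching].
(* One [e1] pays for the sparse tuples of clusters, one for the vertices outside the clusters; the
   third keeps the density above [D']. *)
pose e1 := (D - D') / 3; have e10 : 0 < e1 by rewrite /e1; lra.
have e12 : 0 < e1 / 2 by lra.
(* Quarters of [c' - c] pay for rounding the matching, for the vertices outside the clusters and for
   the gain; one is a reserve. *)
pose ga := (c' - c) / 4; have ga0 : 0 < ga by rewrite /ga; lra.
have rR : 0 < r%:R :> R by [].
(* [K] makes the share of the new tiles small enough for the hypothesis [tM] of [greedy_tiling]. *)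
have [K' HK'] := large_nat r%:R e12.
pose K := K'.+1; have hK : r%:R <= e1 / 2 * K%:R by apply: HK'.
have K0 : 0 < K%:R :> R by [].
exists (ga / K%:R); first by rewrite divr_gt0.
move=> al al0 alc Hal t' t'0.
have [t0 KST] := erdos_complete_partite r t' e12.
(* [La] scales the matching: it makes rounding negligible and brings [t] above the threshold of
   [KST]. *)
have [La' HLa'] := large_nat r%:R ga0.
pose La := (maxn t0 La').+1.
have hLa : r%:R <= ga * La%:R by apply: HLa'; rewrite leqW ?leq_maxr.
pose t := (t' * (K * La))%N.
have t_gt0 : (0 < t)%N by rewrite !muln_gt0 t'0.
have t0t : (t0 <= t)%N.
  apply: leq_trans (_ : La <= _)%N; first by rewrite leqW ?leq_maxl.
  by rewrite /t mulnA leq_pmull // muln_gt0 t'0.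
have [n1 Hn1] := Hal t t_gt0.
have [n2 Hn2] := large_nat (r%:R * t%:R) e10.
have [n3 Hn3] := large_nat (t%:R * c') ga0.
exists (maxn 1 (maxn n1 (maxn n2 (maxn n3 (N0.+1 * t))))) => V.
rewrite !geq_max => /and5P[n_gt0 /Hn1 HV /Hn2 hn2 /Hn3 hn3 hN0] H rH hH.
have [ts [tsH hts]] := HV H rH hH.
have [C [h [h_inj hVC hC]]] := cluster_partition t_gt0 (proj2 (andP tsH)).
set n : R := #|V|%:R in hH hts hn2 hn3 *; set N : R := #|C|%:R.
have n0 : 0 < n by rewrite ltr0n.
have tR : 0 < t%:R :> R by rewrite ltr0n.
have hn : n < N * t%:R + t%:R by rewrite -natrM -natrD ltr_nat.
have hNn : N * t%:R <= n.
  rewrite -natrM ler_nat -[X in (_ * X)%N](card_ord t) -card_prod.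
  exact: leq_card h_inj.
have hN : (N0 <= #|C|)%N.
  rewrite -ltnS -(ltn_pmul2r t_gt0) mulSn addnC; apply: leq_ltn_trans hVC.
  by apply: leq_trans hN0; rewrite leq_mul2r leqnSn orbT.
pose E := [set f : {ffun 'I_r -> C} | e1 * t%:R ^+ r <= #|cluster_edges H h f|%:R].
have dense : D' * N ^+ r < #|E|%:R.
  have := reduced_edges rH h_inj (ltnW hVC); rewrite -(ler_nat R) => red.
  have sumE : (\sum_(f : {ffun 'I_r -> C}) #|cluster_edges H h f|)%N%:R <=
      #|E|%:R * t%:R ^+ r + e1 * t%:R ^+ r * N ^+ r.
    rewrite natr_sum (bigID (mem E)) /= lerD //.
      rewrite [leRHS]mulr_natl -sumr_const ler_sum // => f _.
      rewrite -natrX ler_nat; apply: leq_trans (max_card _) _.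
      by rewrite card_ffun !card_ord.
    apply: le_trans (_ : \sum_(f | f \notin E) e1 * t%:R ^+ r <= _).
      by apply: ler_sum => f; rewrite inE -ltNge => /ltW.
    rewrite sumr_const -[leLHS]mulr_natr ler_wpM2l //.
      by rewrite mulr_ge0 ?exprn_ge0 // ltW.
    rewrite -natrX ler_nat -[X in (_ ^ X)%N](card_ord r) -card_ffun.
    exact: max_card.
  have hrt : (r * (t * #|V| ^ r'))%:R <= e1 * n ^+ r.
    rewrite natrM natrM natrX -/n exprS [leLHS]mulrA [leRHS]mulrA.
    apply: ler_wpM2r; [by apply/exprn_ge0/ltW | exact: hn2].
  have tr0 : 0 < t%:R ^+ r :> R by rewrite exprn_gt0.
  have hpow : (N * t%:R) ^+ r <= n ^+ r.
    by apply: lerXn2r; rewrite ?nnegrE ?mulr_ge0 // ltW.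
  rewrite exprMn in hpow.
  have hp1 := ler_wpM2l (ltW e10) hpow.
  have hp2 : (D - 2 * e1) * (N ^+ r * t%:R ^+ r) <= (D - 2 * e1) * n ^+ r.
    by rewrite ler_wpM2l // /e1; lra.
  have main : (D - 2 * e1) * (N ^+ r * t%:R ^+ r) <= #|E|%:R * t%:R ^+ r.
    apply: le_trans hp2 _; rewrite natrD in red.
    have := le_trans hH red; lra.
  rewrite mulrA ler_pM2r // in main.
  have Np : 0 < N ^+ r.
    rewrite exprn_gt0 // ltr0n lt0n; apply/negP => /eqP C0.
    have : t%:R <= n; last by move=> tn; move: hn; rewrite /N C0 mul0r add0r ltNge tn.
    rewrite ler_nat; apply: leq_trans hN0; exact: leq_pmull.
  apply: lt_le_trans main; rewrite ltr_pM2r // /e1; lra.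
have [y my hy] := matching C hN E dense.
have [L [LE Lload Lsize]] := matching_multiset La my.
have tE : t%:R = K%:R * t'%:R * La%:R :> R by rewrite /t !natrM; ring.
have tM : r%:R * (La * t')%:R <= e1 / 2 * t%:R :> R.
  rewrite tE natrM [leRHS](_ : _ = e1 / 2 * K%:R * (La%:R * t'%:R)); last by ring.
  by rewrite ler_wpM2r // mulr_ge0.
have KST' (F : {set {ffun 'I_r -> 'I_t}}) : e1 / 2 * t%:R ^+ r <= #|F|%:R ->
   exists b : 'I_r -> 'I_t' -> 'I_t, (forall i, injective (b i)) /\
    forall p : {ffun 'I_r -> 'I_t'}, [ffun i => b i (p i)] \in F.
  by move=> hF; apply: KST; rewrite card_ord.
have [||ts1 [ts1H ts1s used]] := greedy_tiling rH h_inj tM KST' (L := L).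
- by move=> f /LE; rewrite inE.
- exact: Lload.
(* As [t = t' * La + t' * (K' * La)], each part of an old tile keeps room for [K' * La] blocks of
   size [t']. *)
have [|ts2 [ts2H ts2s sub2]] := cut_tiling (U := mem (tile_vertices ts1)) (t' := t')
   (m := K' * La) t_gt0 tsH.
  move=> g i /hC-/(_ i)[v hv].
  have -> : [set k | g (i, k) \notin mem (tile_vertices ts1)] =
     ~: [set k | h (v, k) \in tile_vertices ts1] by apply/setP=> k; rewrite !inE hv.
  rewrite cardsCs setCK card_ord leq_subRL; last first.
    by rewrite -[leqRHS](card_ord t) max_card.
  have := leq_trans (used v) (_ : t' * list_load L v <= t' * La)%N.
  rewrite leq_mul2l Lload orbT => /(_ isT) hU.
  apply: leq_trans (leq_add hU (leqnn _)) _.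
  by rewrite /t /K mulSn mulnDr (mulnC (K' * La)%N).
exists (ts2 ++ ts1); split.
  by apply: tiling_cat => // x /sub2[_].
rewrite size_cat ts1s ts2s.
have sizes : K%:R * ((K' * La * size ts + size L) * (r * t'))%:R =
    K'%:R * (size ts * (r * t))%:R + K%:R * t'%:R * (r%:R * (size L)%:R) :> R.
  rewrite /t !(natrM, natrD); ring.
rewrite -(ler_pM2l K0) sizes.
have h1 := ler_wpM2l (ler0n R K') hts.
have h2 := ler_wpM2l (_ : 0 <= K%:R * t'%:R :> R) Lsize.
have {}h2 := h2 (mulr_ge0 (ltW K0) (ler0n _ _)).
have h3 := ler_wpM2l (ler0n R La) hy.
have Kt' : 0 <= K%:R * t'%:R :> R by rewrite mulr_ge0.
have h4 : K%:R * t'%:R * (La%:R * (c' * N) - r%:R * N) <= K%:R * t'%:R * (r%:R * (size L)%:R).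
  apply: le_trans h2; rewrite ler_wpM2l // lerB //.
have h5 : t%:R * N * (c' - ga) <= K%:R * t'%:R * (La%:R * (c' * N) - r%:R * N).
  have -> : t%:R * N * (c' - ga) = K%:R * t'%:R * (La%:R * (c' * N) - ga * La%:R * N).
    by rewrite tE; ring.
  by rewrite ler_wpM2l // lerB // ler_wpM2r.
have cg : 0 <= c' - ga by rewrite /ga; lra.
have h6 : (n - t%:R) * (c' - ga) <= t%:R * N * (c' - ga) by rewrite ler_wpM2r //; lra.
have h7 : K%:R * ((al + ga / K%:R) * n) = K'%:R * (al * n) + al * n + ga * n.
  have KE : K%:R = K'%:R + 1 :> R by rewrite /K -natr1.
  have kg : K%:R * (ga / K%:R) = ga by rewrite mulrC divfK // gt_eqF.
  by rewrite mulrA mulrDr kg KE; ring.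
rewrite h7; have h8 : 0 <= ga * t%:R by rewrite mulr_ge0 ?ler0n ?ltW.
have h9 : al * n <= c * n by rewrite ler_wpM2r // ltW.
have h10 : 4 * (ga * n) = c' * n - c * n by rewrite /ga; field.
have h11 : 0 <= ga * n by rewrite mulr_ge0 ?ltW.
move: h1 (le_trans h6 (le_trans h5 h4)) hn3 h8 h9 h10 h11.
move: (K'%:R * (al * n)) (K'%:R * _) (K%:R * t'%:R * _) => X Y Z; clear; lra.
Qed.

(** Starting from proportion 0, finitely many increments of the same size [dl] pass [c]. *)
Theorem tilings_exist (c c' D D' : R) : 0 < c -> c < c' -> 0 <= D' -> D' < D ->
  (exists N0, forall C : finType, (N0 <= #|C|)%N -> forall E : {set {ffun 'I_r -> C}},
    D' * #|C|%:R ^+ r < #|E|%:R ->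
    exists2 y, fractional_matching E y & c' * #|C|%:R <= r%:R * \sum_f y f) ->
  exists2 al, c < al & has_tilings D al.
Proof.
move=> c0 cc' D'0 DD' matching.
have [dl dl0 step] := tilings_step c0 cc' D'0 DD' matching.
have tilings0 : has_tilings D 0.
  move=> t t0; exists 0%N => V _ H _ _; exists [::]; split=> //.
  by rewrite mul0r.
have [m hm] : exists m, forall j, (m <= j)%N -> c <= dl * j%:R by apply: large_nat.
suff : forall j, has_tilings D (dl * j%:R) \/ exists2 al, c < al & has_tilings D al.
  case/(_ m.+1) => // H; exists (dl * m.+1%:R) => //.
  by rewrite -natr1 mulrDr mulr1; have := hm m (leqnn m); lra.
elim=> [|j [IH|]]; [by left; rewrite mulr0| |by right].
have [h|h] := lerP (dl * j%:R) c; last by right; exists (dl * j%:R).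
by left; rewrite -natr1 mulrDr mulr1; apply: step => //; rewrite mulr_ge0 // ltW.
Qed.

End Improvement.

(** * Tight paths and tight linear forests *)

Section Windows.
Variables (T : finType) (r : nat).
Implicit Types (s : seq T) (E : {set {set T}}).

Definition window s i : {set T} := [set x in take r (drop i s)].

Lemma tight_path_edgesP s (e : {set T}) :
  reflect (exists2 i, i + r <= size s & e = window s i) (e \in tight_path_edges r s).
Proof.
apply: (iffP imsetP) => [[i _ ->]|[i hi ->]].
  by exists i => //; have := ltn_ord i; lia.
have hi' : i < (size s).+1 - r by lia.
by exists (Ordinal hi').
Qed.

Lemma mem_window s i x : uniq s -> x \in window s i ->
  [/\ x \in s, i <= index x s & index x s < i + r].
Proof.
move=> us; rewrite inE => /(nthP x)[k]; rewrite size_take_min size_drop leq_min.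
case/andP=> kr ks; rewrite nth_take // nth_drop => <-.
have hs : i + k < size s by rewrite -ltn_subRL.
by rewrite mem_nth // index_uniq //; split=> //; [exact: leq_addr | rewrite ltn_add2l].
Qed.

Lemma size_drop_window s i : i + r <= size s -> r <= size (drop i s).
Proof. by move=> h; rewrite size_drop leq_subRL // (leq_trans (leq_addr _ _) h). Qed.

Lemma nth_window x0 s i j : i + r <= size s -> i <= j < i + r -> nth x0 s j \in window s i.
Proof.
move=> hi /andP[ij jr]; have jr' : j - i < r by lia.
rewrite inE -(subnKC ij) -nth_drop -(nth_take x0 jr') mem_nth //.
by rewrite size_takel // size_drop_window.
Qed.

Lemma card_window s i : uniq s -> i + r <= size s -> #|window s i| = r.
Proof.
move=> us hi; rewrite cardsE; have /card_uniqP -> : uniq (take r (drop i s)).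
  by rewrite take_uniq // drop_uniq.
by rewrite size_takel // size_drop_window.
Qed.

Lemma window_take s m i : i + r <= m -> window (take m s) i = window s i.
Proof. by move=> hm; rewrite /window !take_drop take_takel // addnC. Qed.

Lemma card_tight_path_edges s : uniq s -> 0 < r -> #|tight_path_edges r s| = (size s).+1 - r.
Proof.
move=> us r0; rewrite card_imset ?card_ord //.
have lt_inj (i j : 'I_((size s).+1 - r)) : i < j -> window s i = window s j -> False.
  move=> ij e; have hi := ltn_ord i; have hj := ltn_ord j.
  have : 0 < size s by lia.
  rewrite -has_predT => /hasP[x0 _ _].
  have [i_le i_lt] : i + r <= size s /\ i < size s by lia.
  have : nth x0 s i \in window s j.
    by rewrite -e nth_window // leqnn -[ltnLHS]addn0 ltn_add2l.
  by case/mem_window=> // _; rewrite index_uniq // leqNgt ij.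
move=> i j e; apply/val_inj; case: (ltngtP i j) => // h.
  by case: (lt_inj i j h e).
by case: (lt_inj j i h (esym e)).
Qed.

(** The edges through [x] lie in its component. On a tight path they are windows, whose start is one
    of the last [r] positions up to that of [x]. *)
Lemma forest_degree E x : is_tight_linear_forest r E ->
  #|[set e in E | x \in e]| <= r.
Proof.
case/andP=> _ /forallP/(_ x) /=; set C := component E x.
have sub : [set e in E | x \in e] \subset [set e in edges_in E C | x \in e].
  apply/subsetP=> e; rewrite !inE => /andP[eE xe]; rewrite eE xe andbT /=.
  apply/subsetP=> y ye; rewrite inE; apply: connect1; apply/existsP; exists e.
  by rewrite eE xe ye.
case/orP=> [/existsP[s /and3P[us _ /eqP edgesE]]|/andP[_ /eqP edges0]]; last first.
  by apply: leq_trans (subset_leq_card sub) _; rewrite edges0 (eq_card0 (A := _)) // => e; rewrite !inE.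
apply: leq_trans (subset_leq_card sub) _; rewrite edgesE.
apply: (@leq_trans #|[set window s (index x s - nat_of_ord j) | j in [set: 'I_r]]|); last first.
  by rewrite (leq_trans (leq_imset_card _ _)) // cardsT card_ord.
apply/subset_leq_card/subsetP=> e; rewrite inE => /andP[/tight_path_edgesP[i hi ->]].
case/mem_window=> // xs ix xi; have jr : index x s - i < r by rewrite ltn_subLR.
by apply/imsetP; exists (Ordinal jr); rewrite ?inE /= ?subKn.
Qed.

Lemma forest_incidence (U : finType) (f : T -> U) (A : {set U}) E :
  is_tight_linear_forest r E -> injective f ->
  \sum_(e in E) #|[set x in e | f x \in A]| <= r * #|A|.
Proof.
move=> forE finj.
have -> : \sum_(e in E) #|[set x in e | f x \in A]| =
    \sum_(x | f x \in A) #|[set e in E | x \in e]|.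
  transitivity (\sum_(e in E) \sum_(x | f x \in A) (x \in e)).
    apply: eq_bigr => e _; rewrite -sum1dep_card big_mkcondl /= big_mkcond [RHS]big_mkcond.
    by apply: eq_bigr => x _; case: (f x \in A); case: (x \in e).
  rewrite exchange_big /=; apply: eq_bigr => x _; rewrite -sum1dep_card big_mkcondr /=.
  by apply: eq_bigr => e _; case: (x \in e).
apply: leq_trans (_ : \sum_(x | f x \in A) r <= _).
  by apply: leq_sum => x _; apply: forest_degree.
rewrite sum_nat_cond_const mulnC leq_mul2l; apply/orP; right.
rewrite -(card_imset _ finj); apply/subset_leq_card/subsetP => y /imsetP[x].
by rewrite inE => fA ->.
Qed.

End Windows.

(** * The two extremal constructions *)

Section LowerBound.
Variables (r n k : nat).

Lemma leq_turan_number (Fam : hfamily) (H : {set {set 'I_n}}) :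
  is_rgraph r H -> free_of Fam H -> #|H| <= turan_number r n Fam.
Proof.
move=> rH fH; rewrite /turan_number (bigD1 H) /=; first exact: leq_maxl.
by rewrite rH; apply/boolp.asboolT.
Qed.

Lemma ord_lt_card m : m <= n -> #|[set x : 'I_n | x < m]| = m.
Proof.
move=> mn; have inj : injective (widen_ord mn).
  by move=> i j e; apply: val_inj; apply: (congr1 val e).
rewrite -[RHS](card_ord m) -(card_imset _ inj).
apply: eq_card => x; rewrite inE; apply/idP/imsetP => [xm|[y _ ->]]; last exact: (ltn_ord y).
by exists (Ordinal xm) => //; apply/val_inj.
Qed.

(** All [r] vertices of each edge lie in the clique, so a copy would have [r * k] incidences with
    it, against the [r * (k - 1)] allowed by [forest_incidence]. *)
Lemma turan_clique_lower : 0 < r -> 0 < k -> k <= n ->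
  'C(k.-1, r) <= turan_number r n (tight_linear_forests r n k).
Proof.
move=> r0 k0 kn; pose K := [set x : 'I_n | x < k.-1].
have cK : #|K| = k.-1 by apply: ord_lt_card; lia.
rewrite -cK -cards_draws; apply: leq_turan_number.
  by apply/forallP=> e; apply/implyP; rewrite inE => /andP[].
move=> T F [_ forF cF]; apply/negP => /existsP[f /andP[/injectiveP finj /forallP HF]].
have := forest_incidence K forF finj; rewrite cK leqNgt => /negP; apply.
rewrite (eq_bigr (fun=> r)); last first.
  move=> e eF; have /implyP/(_ eF) := HF e; rewrite inE => /andP[/subsetP sub _].
  have /andP[/forallP/(_ e)/implyP/(_ eF)/eqP ce _] := forF.
  rewrite -[RHS]ce; apply: eq_card => x; rewrite !inE andb_idr // => xe.
  by have := sub (f x) (imset_f _ xe); rewrite inE.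
by rewrite sum_nat_const cF [ltnRHS]mulnC ltn_mul2l r0 ltn_predL.
Qed.

(** Each edge meets the set [A] of [s - 1] vertices, so a forest in this r-graph has at most
    [r * (s - 1) < k] edges. *)
Lemma turan_cover_lower s : 0 < r -> 0 < s -> s <= n -> r * s <= k ->
  'C(n, r) - 'C(n - s.-1, r) <= turan_number r n (tight_linear_forests r n k).
Proof.
move=> r0 s0 sn rsk; pose A := [set x : 'I_n | x < s.-1].
have cA : #|A| = s.-1 by apply: ord_lt_card; lia.
pose H := [set e : {set 'I_n} | ~~ (e \subset ~: A) && (#|e| == r)].
have -> : 'C(n, r) - 'C(n - s.-1, r) = #|H|.
  have -> : #|H| = #|[set e : {set 'I_n} | (e \subset setT) && (#|e| == r)] :\:
      [set e : {set 'I_n} | (e \subset ~: A) && (#|e| == r)]|.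
    apply: eq_card => e; rewrite !inE subsetT /=.
    by case: (e \subset ~: A); case: (#|e| == r).
  rewrite cardsD (setIidPr _) ?cards_draws.
    by rewrite cardsT cardsCs setCK cA card_ord.
  by apply/subsetP=> e; rewrite !inE subsetT => /andP[_ ->].
apply: leq_turan_number.
  by apply/forallP=> e; apply/implyP; rewrite inE => /andP[].
move=> T F [_ forF cF]; apply/negP => /existsP[f /andP[/injectiveP finj /forallP HF]].
have := forest_incidence A forF finj; rewrite cA leqNgt => /negP; apply.
apply: (@leq_trans (\sum_(e in F) 1)).
  by rewrite sum_nat_const muln1 cF; apply: leq_trans rsk; rewrite ltn_mul2l r0 ltn_predL.
apply: leq_sum => e eF; have /implyP/(_ eF) := HF e; rewrite inE => /andP[+ _].
case/subsetPn=> y /imsetP[x xe ->]; rewrite inE negbK => fxA.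
by apply/card_gt0P; exists x; rewrite inE xe.
Qed.

End LowerBound.

(** * Disjoint unions of tight paths *)

Section PathForest.
Variables (T : finType) (r : nat).
Implicit Types (s : seq T) (ss : seq (seq T)).

Definition path_forest ss : {set {set T}} :=
  [set e | has (fun s => e \in tight_path_edges r s) ss].

Lemma path_forestP ss e :
  reflect (exists2 s, s \in ss & e \in tight_path_edges r s) (e \in path_forest ss).
Proof. by rewrite inE; apply: hasP. Qed.

Lemma uniq_flatten_mem ss s s' x : uniq (flatten ss) -> s \in ss -> s' \in ss ->
  x \in s -> x \in s' -> s = s'.
Proof.
elim: ss => //= a ss IH; rewrite cat_uniq => /and3P[ua /hasPn disj uss].
rewrite !inE => /predU1P[->|sss] /predU1P[->|s'ss] // xs xs'.
- have xf : x \in flatten ss by apply/flattenP; exists s'.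
  by have := disj x xf; rewrite /= xs.
- have xf : x \in flatten ss by apply/flattenP; exists s.
  by have := disj x xf; rewrite /= xs'.
- exact: IH.
Qed.

Lemma uniq_flatten_uniq ss s : uniq (flatten ss) -> s \in ss -> uniq s.
Proof.
elim: ss => //= a ss IH; rewrite cat_uniq => /and3P[ua _ uss].
by rewrite inE => /predU1P[->|/IH]; [|apply].
Qed.

Lemma window_sub s e x : e \in tight_path_edges r s -> x \in e -> x \in s.
Proof.
case/tight_path_edgesP=> i hi ->; rewrite inE => /mem_take/mem_drop; exact.
Qed.

Lemma hadj_sym (E : {set {set T}}) : symmetric (hadj E).
Proof. by move=> a b; apply: eq_existsb => e; rewrite [(a \in e) && _]andbC. Qed.

Hypothesis r_gt1 : 1 < r.

Lemma tight_path_connected (E : {set {set T}}) s x y : uniq s -> r <= size s ->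
  tight_path_edges r s \subset E -> x \in s -> y \in s -> connect (hadj E) x y.
Proof.
move=> us rs /subsetP sE xs ys.
have adj j : j.+1 < size s -> connect (hadj E) (nth x s j) (nth x s j.+1).
  (* The window starting at [j], moved back if it would overrun the end, contains positions [j] and
     [j.+1] because [r > 1]. *)
  move=> hj; apply: connect1; pose i := minn j (size s - r).
  have [hi hij hij'] : [/\ i + r <= size s, i <= j & j.+1 < i + r].
    by rewrite /i; split; move: (size s) hj rs => m; lia.
  apply/existsP; exists (window r s i).
  rewrite sE; last by apply/tight_path_edgesP; exists i.
  by rewrite !nth_window //=; lia.
have conn j : j < size s -> connect (hadj E) (nth x s 0) (nth x s j).
  elim: j => [|j IH] hj; first exact: connect0.
  by apply: connect_trans (IH (ltnW hj)) (adj _ hj).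
rewrite -(nth_index x xs) -[in X in connect _ _ X](nth_index x ys).
apply: connect_trans (conn _ _); last by rewrite index_mem.
by rewrite (sym_connect_sym (hadj_sym E)) conn // index_mem.
Qed.

Lemma component_path ss s x : uniq (flatten ss) -> (forall s, s \in ss -> r <= size s) ->
  s \in ss -> x \in s -> component (path_forest ss) x = [set y in s].
Proof.
move=> uss ssr sss xs; apply/setP=> y; rewrite !inE; apply/idP/idP; last first.
  move=> ys; apply: (tight_path_connected (uniq_flatten_uniq uss sss)) => //.
    exact: ssr.
  by apply/subsetP=> e es; apply/path_forestP; exists s.
have cl : closed (hadj (path_forest ss)) (mem s).
  apply: intro_closed; first exact/sym_connect_sym/hadj_sym.
  move=> a b /existsP[e /and3P[/path_forestP[s' s'ss es'] ae be]] /= as_.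
  rewrite (uniq_flatten_mem uss sss s'ss as_ (window_sub es' ae)).
  exact: window_sub be.
by move=> /(closed_connect cl) <-.
Qed.

Lemma path_forest_tight ss : uniq (flatten ss) -> (forall s, s \in ss -> r <= size s) ->
  is_tight_linear_forest r (path_forest ss).
Proof.
move=> uss ssr; have cardE e : e \in path_forest ss -> #|e| = r.
  case/path_forestP=> s sss /tight_path_edgesP[i hi ->].
  exact/card_window/hi/(uniq_flatten_uniq uss sss).
apply/andP; split; first by apply/forallP=> e; apply/implyP=> /cardE->.
apply/forallP=> x /=; case: (boolP (x \in flatten ss)) => [/flattenP[s sss xs]|xn].
  rewrite (component_path uss ssr sss xs); apply/orP; left.
  have us := uniq_flatten_uniq uss sss.
  have sizeE : size s == #|[set y in s]| by rewrite cardsE; apply/eqP/esym/card_uniqP.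
  apply/existsP; exists (Tuple sizeE); rewrite us eqxx /=; apply/eqP/setP=> e.
  rewrite inE; apply/andP/idP => [[/path_forestP[s' s'ss es'] /subsetP sub]|es].
    have : e != set0.
      by rewrite -cards_eq0 cardE; [rewrite -lt0n ltnW | apply/path_forestP; exists s'].
    case/set0Pn=> y ye; have := sub y ye; rewrite inE => ys.
    by rewrite (uniq_flatten_mem uss sss s'ss ys (window_sub es' ye)).
  split; first by apply/path_forestP; exists s.
  by apply/subsetP=> y ye; rewrite inE (window_sub es ye).
have compE : component (path_forest ss) x = [set x].
  apply/setP=> y; rewrite !inE; apply/idP/eqP => [|->]; last exact: connect0.
  case/connectP=> -[|z p] //= /andP[/existsP[e /and3P[/path_forestP[s sss es] xe _]] _] _.
  by case/negP: xn; apply/flattenP; exists s => //; apply: window_sub xe.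
rewrite compE; apply/orP; right; rewrite /is_isolated_vertex cards1 eqxx /=.
apply/eqP/setP=> e; rewrite !inE; apply/negbTE/negP => /andP[eF /subset_leq_card].
rewrite cards1 cardE; first by rewrite leqNgt r_gt1.
by apply/path_forestP/hasP.
Qed.

Lemma card_path_forest ss : uniq (flatten ss) -> (forall s, s \in ss -> r <= size s) ->
  #|path_forest ss| = \sum_(s <- ss) ((size s).+1 - r).
Proof.
elim: ss => [|s ss IH] /= uss ssr.
  by rewrite big_nil; apply: eq_card0 => e; rewrite inE.
move: (uss); rewrite cat_uniq => /and3P[us _ uss'].
rewrite big_cons -IH //; last by move=> s' hs'; apply: ssr; rewrite inE hs' orbT.
rewrite -card_tight_path_edges //; last exact: ltnW.
have -> : path_forest (s :: ss) = tight_path_edges r s :|: path_forest ss.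
  by apply/setP=> e; rewrite !inE.
rewrite cardsU [X in _ - X](_ : _ = 0) ?subn0 //; apply/eqP; rewrite cards_eq0.
apply/eqP/setP=> e; rewrite !inE; apply/negbTE/negP => /andP[es /hasP[s' s'ss es']].
case/tight_path_edgesP: (es) => i hi ew.
have : e != set0 by rewrite ew -cards_eq0 card_window // -lt0n ltnW.
case/set0Pn=> y ye.
have /hasPn/(_ y) : ~~ has (mem s) (flatten ss) by move: uss; rewrite cat_uniq => /and3P[].
have yf : y \in flatten ss by apply/flattenP; exists s' => //; apply: window_sub ye.
by move=> /(_ yf); rewrite /= (window_sub es ye).
Qed.

(** Whole paths are kept while the count permits, then a prefix of the next one. The last clause
    makes windows of the new paths windows of old ones. *)
Lemma trim_paths ss k : uniq (flatten ss) -> (forall s, s \in ss -> r <= size s) ->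
  k <= \sum_(s <- ss) ((size s).+1 - r) ->
  exists ss', [/\ uniq (flatten ss'), forall s, s \in ss' -> r <= size s,
    \sum_(s <- ss') ((size s).+1 - r) = k,
    {subset flatten ss' <= flatten ss} &
    forall s', s' \in ss' -> exists2 s, s \in ss & exists m, s' = take m s].
Proof.
elim: ss k => [|s ss IH] k uss ssr.
  by rewrite big_nil leqn0 => /eqP ->; exists [::]; split=> //; rewrite big_nil.
move: (uss); rewrite /= cat_uniq => /and3P[us disj uss'].
rewrite big_cons => hk; have rs : r <= size s by apply: ssr; rewrite mem_head.
have [k0|k0] := posnP k.
  by exists [::]; rewrite big_nil; split.
have [hks|hks] := leqP ((size s).+1 - r) k.
  have [|| ss' [u' r' sum' sub' take']] := IH (k - ((size s).+1 - r)) uss'.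
  - by move=> s' h; apply: ssr; rewrite inE h orbT.
  - by rewrite leq_subLR.
  exists (s :: ss'); split.
  - rewrite /= cat_uniq us u' andbT /=; apply/hasPn=> x /sub'.
    exact: (hasPn disj).
  - by move=> s'; rewrite inE => /predU1P[->|/r'].
  - by rewrite big_cons sum' subnKC.
  - by move=> x; rewrite !mem_cat => /orP[->|/sub' ->] //; rewrite orbT.
  - move=> s'; rewrite inE => /predU1P[->|/take'[s1 s1ss [m ->]]].
      by exists s; rewrite ?mem_head //; exists (size s); rewrite take_size.
    by exists s1; rewrite ?inE ?s1ss ?orbT //; exists m.
(* A tight path on [k + r - 1] vertices has exactly [k] edges. *)
have sz : size (take (k + r.-1) s) = k + r.-1.
  by rewrite size_takel //; move: (size s) hks rs => m; lia.
exists [:: take (k + r.-1) s]; split.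
- by rewrite /= cats0 take_uniq.
- by move=> s'; rewrite inE => /eqP ->; rewrite sz; lia.
- by rewrite big_seq1 sz; lia.
- by move=> x; rewrite /= cats0 mem_cat => /mem_take ->.
- by move=> s'; rewrite inE => /eqP ->; exists s; rewrite ?mem_head //; exists (k + r.-1).
Qed.

End PathForest.

(** * Tight paths spanning a tile *)

Section TilePath.
Variables (V : finType) (r' t' : nat).
Local Notation r := r'.+1.
Local Notation t := t'.+1.
Implicit Type g : {ffun 'I_r * 'I_t -> V}.

(** The path visits the parts cyclically, so any [r] consecutive vertices meet every part once. *)
Let pos (p : nat) : 'I_r * 'I_t := (inord (p %% r), inord (p %/ r)).
Let order := [seq pos p | p <- iota 0 (r * t)].

Definition tile_path g : seq V := [seq g x | x <- order].

Let perm_order : perm_eq order (enum {: 'I_r * 'I_t}).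
Proof.
apply: uniq_perm; last 1 first.
- move=> [i k]; rewrite mem_enum; apply/mapP; exists (k * r + i).
    rewrite mem_iota /=; have := ltn_ord i; have := ltn_ord k; nia.
  by rewrite /pos modnMDl modn_small // divnMDl // divn_small // addn0 !inord_val.
- rewrite map_inj_in_uniq ?iota_uniq // => p q.
  rewrite !mem_iota !add0n /= => hp hq [].
  have hd x : x < r * t -> x %/ r < t by move=> h; rewrite ltn_divLR // mulnC.
  move/(congr1 (@nat_of_ord _)); rewrite !inordK ?ltn_mod // => e1 /(congr1 (@nat_of_ord _)).
  by rewrite !inordK ?hd // => e2; rewrite (divn_eq p r) (divn_eq q r) e1 e2.
- exact: enum_uniq.
Qed.

Lemma size_tile_path g : size (tile_path g) = r * t.
Proof. by rewrite !size_map size_iota. Qed.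

Lemma perm_tile_path g : perm_eq (tile_path g) (codom g).
Proof. exact: perm_map perm_order. Qed.

Lemma tile_path_edges (H : {set {set V}}) g : tile_in H g -> uniq (codom g) ->
  tight_path_edges r (tile_path g) \subset H.
Proof.
move=> gH ug; have ut : uniq (tile_path g) by rewrite (perm_uniq (perm_tile_path g)).
apply/subsetP=> e /tight_path_edgesP[i hi ->].
(* A window starting at [i] meets the parts from [i %% r] on at level [i %/ r], and the earlier
   parts one level higher. *)
pose psi : {ffun 'I_r -> 'I_t} :=
  [ffun a : 'I_r => inord (if a < i %% r then (i %/ r).+1 else i %/ r)].
suff -> : window r (tile_path g) i = [set g (a, psi a) | a : 'I_r] by move/forallP: gH.
apply/eqP; rewrite eqEcard; apply/andP; split; last first.
  by rewrite card_window //; apply: leq_trans (leq_imset_card _ _) _; rewrite card_ord.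
apply/subsetP=> x; rewrite inE; have x0 := g (ord0, ord0).
move=> /(nthP x0)[l]; rewrite size_takel ?size_drop_window // => lr <-.
rewrite nth_take // nth_drop; move: hi; rewrite size_tile_path => hi.
have hl : i + l < r * t by lia.
rewrite (nth_map (ord0, ord0)) ?size_map ?size_iota // (nth_map 0) ?size_iota //.
rewrite nth_iota // add0n; apply/imsetP; exists (inord ((i + l) %% r)) => //.
rewrite /pos /psi ffunE inordK ?ltn_mod //; congr (g (_, inord _)).
have ei := divn_eq i r; have hm : i %% r < r by rewrite ltn_mod.
case: (ltnP (i %% r + l) r) => h.
  have -> : (i + l) %/ r = i %/ r.
    by rewrite {1}ei -addnA divnMDl // (divn_small h) addn0.
  have -> : (i + l) %% r = i %% r + l by rewrite {1}ei -addnA modnMDl modn_small.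
  by rewrite ltnNge leq_addr.
have e2 : i + l = (i %/ r).+1 * r + (i %% r + l - r) by lia.
have h2 : i %% r + l - r < r by lia.
rewrite e2 divnMDl // (divn_small h2) addn0 modnMDl (modn_small h2).
by rewrite ifT //; lia.
Qed.

Lemma tiling_forest (H : {set {set V}}) (ts : seq {ffun 'I_r * 'I_t -> V}) k :
  1 < r -> tiling H ts -> k <= size ts * ((r * t).+1 - r) ->
  exists F : {set {set V}}, [/\ is_tight_linear_forest r F, #|F| = k & F \subset H].
Proof.
move=> r1 tsH hk; have /andP[/allP inH uts] := tsH.
pose ss := [seq tile_path g | g <- ts].
have uss : uniq (flatten ss).
  suff /perm_uniq -> : perm_eq (flatten ss) (tile_vertices ts) by [].
  rewrite /ss /tile_vertices; elim: (ts) => //= g l IH.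
  exact: perm_cat (perm_tile_path g) IH.
have ssr s : s \in ss -> r <= size s.
  by case/mapP=> g _ ->; rewrite size_tile_path leq_pmulr.
have [|ss' [uss' ssr' sum' _ tk]] := trim_paths r1 uss ssr (k := k).
  rewrite big_map (eq_bigr (fun=> (r * t).+1 - r)); last by move=> g _; rewrite size_tile_path.
  by rewrite big_const_seq count_predT iter_addn_0 mulnC.
exists (path_forest r ss'); split; first exact: path_forest_tight.
  by rewrite card_path_forest.
apply/subsetP=> e /path_forestP[s' /tk[s sss [m ->]]].
case/tight_path_edgesP=> i hi ->; move/mapP: sss => [g gts sE].
have him : i + r <= m.
  by apply: leq_trans hi _; rewrite size_take_min geq_minl.
have his : i + r <= size s.
  by apply: leq_trans hi _; rewrite size_take_min geq_minr.
rewrite window_take // sE; rewrite sE in his.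
have ug : uniq (codom g).
  by apply: (uniq_flatten_uniq uts); apply: map_f.
apply: (subsetP (tile_path_edges (inH g gts) ug)).
by apply/tight_path_edgesP; exists i.
Qed.

End TilePath.

(** The forest lives on the vertex set of [H] itself, so the identity embeds it. *)
Lemma tiling_not_free (n r' t' k : nat) (H : {set {set 'I_n}})
    (ts : seq {ffun 'I_r'.+1 * 'I_t'.+1 -> 'I_n}) :
  0 < r' -> tiling H ts -> k <= size ts * ((r'.+1 * t'.+1).+1 - r'.+1) ->
  ~ free_of (tight_linear_forests r'.+1 n k) H.
Proof.
move=> r1 tsH hk fH.
have [F [forF cF /subsetP FH]] := tiling_forest (r1 : 1 < r'.+1) tsH hk.
have /negP := fH _ F (And3 (card_ord n) forF cF); apply.
apply/existsP; exists [ffun x => x]; apply/andP; split.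
  by apply/injectiveP=> x y; rewrite !ffunE.
apply/forallP=> e; apply/implyP=> /FH eH; rewrite (_ : _ @: e = e) //.
rewrite -[RHS]imset_id; apply: eq_imset => x; exact: ffunE.
Qed.

(** * Asymptotics *)

Section Asymptotics.
Local Open Scope ring_scope.
Variable R : archiRealFieldType.

Lemma expr_dist_le (a b : R) r : 0 <= a <= 1 -> 0 <= b <= 1 ->
  `|b ^+ r - a ^+ r| <= r%:R * `|b - a|.
Proof.
wlog ab : a b / a <= b => [H|] /andP[a0 a1] /andP[b0 b1].
  case/orP: (le_total a b) => ab; first by apply: H => //; apply/andP.
  by rewrite distrC (distrC b); apply: H => //; apply/andP.
rewrite !ger0_norm ?subr_ge0 //; first exact: expr_diff_le.
by apply: lerXn2r.
Qed.

(** The scaled binomial lies between [(m - r) ^ r] and [m ^ r], whose bases differ from [ga * n] by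
    at most [K + r]. *)
Lemma bin_asymptotic (r : nat) (ga K eps : R) : 0 <= ga <= 1 -> 0 < eps ->
  exists n0, forall n m, (n0 <= n)%N -> (m <= n)%N -> `|m%:R - ga * n%:R| <= K ->
  `|(r`! * 'C(m, r))%:R - ga ^+ r * n%:R ^+ r| <= eps * n%:R ^+ r.
Proof.
move=> hga eps0; have [n0 Hn0] := large_nat (r%:R * (K + r%:R)) eps0.
exists (maxn 1 n0) => n m; rewrite geq_max => /andP[n_gt0 /Hn0 hn] mn hm.
have nR : 0 < n%:R :> R by rewrite ltr0n.
have nE : n%:R != 0 :> R by rewrite gt_eqF.
have close (l : nat) : (l <= m)%N -> m%:R <= l%:R + r%:R :> R ->
   `|(l ^ r)%:R - ga ^+ r * n%:R ^+ r| <= eps * n%:R ^+ r.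
  move=> lm ml; have l1 : 0 <= (l%:R / n%:R : R) <= 1.
    by rewrite divr_ge0 ?ler0n //= ler_pdivrMr // mul1r ler_nat (leq_trans lm).
  have -> : (l ^ r)%:R - ga ^+ r * n%:R ^+ r = ((l%:R / n%:R) ^+ r - ga ^+ r) * n%:R ^+ r.
    by rewrite mulrBl -[X in _ = X - _]exprMn divfK // natrX.
  have nr0 : 0 < n%:R ^+ r :> R by rewrite exprn_gt0.
  rewrite normrM (gtr0_norm nr0) ler_pM2r //; apply: le_trans (expr_dist_le r hga l1) _.
  rewrite -(ler_pM2r nR) -mulrA -{2}[n%:R](gtr0_norm nR) -normrM mulrBl divfK //.
  apply: le_trans hn; rewrite ler_wpM2l //.
  have lm' : l%:R <= m%:R :> R by rewrite ler_nat.
  have r0 : 0 <= r%:R :> R by [].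
  rewrite ler_norml; move: hm; rewrite ler_norml => /andP[h1 h2].
  by apply/andP; split; lra.
have r0 : 0 <= r%:R :> R by [].
have up := close m (leqnn m); rewrite lerDl r0 in up; have {}up := up isT.
have low : `|((m - r) ^ r)%:R - ga ^+ r * n%:R ^+ r| <= eps * n%:R ^+ r.
  by apply: close; [exact: leq_subr | rewrite -natrD ler_nat; lia].
have binE : (r`! * 'C(m, r) = m ^_ r)%N by rewrite mulnC bin_ffact.
have hlow : ((m - r) ^ r)%:R <= (m ^_ r)%:R :> R by rewrite ler_nat ffact_ge.
have hup : (m ^_ r)%:R <= (m ^ r)%:R :> R.
  rewrite ler_nat ffact_prod -[X in (_ ^ X)%N](card_ord r) -prod_nat_const.
  by apply: leq_prod => i _; apply: leq_subr.
rewrite binE; move: up low; rewrite !ler_norml => /andP[_ h1] /andP[h2 _].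
by apply/andP; split; lra.
Qed.

Lemma limit_density_ge0 r (c : R) : 0 <= c -> 0 <= limit_density r c.
Proof. by move=> c0; rewrite le_max exprn_ge0. Qed.

(** A denser free r-graph would have a tiling covering a proportion [al > c], and the spanning paths
    of its tiles contain a forbidden forest. *)
Lemma turan_upper (r : nat) (c eps : R) : (3 <= r)%N -> 0 < c ->
  (r = 3%N -> c < 1) -> ((4 <= r)%N -> c < 1 / 2) -> 0 < eps ->
  exists n0, forall n, (n0 <= n)%N ->
  (r`! * turan_number r n (tight_linear_forests r n (Num.truncn (c * n%:R))))%:R <=
    (limit_density r c + eps) * n%:R ^+ r.
Proof.
move=> r3 c0 hc3 hc4 eps0; have e2 : 0 < eps / 2 by lra.
have [c' cc' matching] := large_fractional_matching r3 c0 hc3 hc4 e2.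
have mu0 := limit_density_ge0 r (ltW c0).
case: r r3 hc3 hc4 matching mu0 => [//|r'] r3 hc3 hc4 matching mu0.
have [|| al c_al tile] := tilings_exist (D := limit_density r'.+1 c + eps) c0 cc' _ _ matching.
- by lra.
- by lra.
have alc : 0 < al - c by lra.
(* A path through a tile of size [t' + 1] has more than [r * t'] edges; [t'] is chosen with
   [al * t' >= c * (t' + 1)], to make up for the path ends. *)
have [t' Ht'] := large_nat al alc.
have [n0 Hn0] := tile t'.+1 (ltn0Sn t').
exists n0 => n hn; rewrite leNgt; apply/negP => hlt.
have [H [rH fH hH]] : exists H : {set {set 'I_n}}, [/\ is_rgraph r'.+1 H,
    free_of (tight_linear_forests r'.+1 n (Num.truncn (c * n%:R))) H &
    (limit_density r'.+1 c + eps) * n%:R ^+ r'.+1 <= ((r'.+1)`! * #|H|)%:R].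
  apply: boolp.contrapT => hno; move: hlt; apply/negP; rewrite -leNgt.
  have pos : 0 <= (limit_density r'.+1 c + eps) * n%:R ^+ r'.+1.
    by rewrite mulr_ge0 ?exprn_ge0 // addr_ge0 // ltW.
  rewrite /turan_number; elim/big_ind: _ => [|x y hx hy|H /andP[rH /boolp.asboolP fH]].
  - by rewrite muln0.
  - by rewrite /maxn; case: ifP.
  - have [//|/ltW h] := lerP ((r'.+1)`! * #|H|)%:R ((limit_density r'.+1 c + eps) * n%:R ^+ r'.+1).
    by case: hno; exists H.
have [||ts [tsH hts]] := Hn0 'I_n _ H rH.
- by rewrite card_ord.
- by rewrite card_ord.
rewrite card_ord in hts.
apply: (tiling_not_free (ltnW (r3 : 1 < r')%N) tsH _ fH).
have -> : ((r'.+1 * t'.+1).+1 - r'.+1 = r'.+1 * t' + 1)%N.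
  by rewrite mulnS -addnS addKn addn1.
rewrite -(ler_nat R); apply: le_trans (_ : c * n%:R <= _).
  by rewrite truncn_le mulr_ge0 // ltW.
apply: le_trans (_ : (size ts * (r'.+1 * t'))%:R <= _); last first.
  by rewrite ler_nat leq_mul2l leq_addr orbT.
have tR : 0 < t'.+1%:R :> R by [].
rewrite -(ler_pM2r tR).
have -> : (size ts * (r'.+1 * t'))%:R * t'.+1%:R = t'%:R * (size ts * (r'.+1 * t'.+1))%:R :> R.
  by rewrite -!natrM; congr _%:R; ring.
have t'0 : 0 <= t'%:R :> R by [].
apply: le_trans (ler_wpM2l t'0 hts).
have nn : 0 <= n%:R :> R by [].
have h := ler_wpM2r nn (Ht' t'.+1 (leqnSn t')).
rewrite -natr1 in h *; lra.
Qed.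

Lemma trunc_close (x : R) : 0 <= x -> `|(Num.truncn x)%:R - x| <= 1.
Proof.
move=> x0; have /andP[h1 h2] := truncn_itv x0; rewrite -natr1 in h2.
by rewrite ler_norml; apply/andP; split; lra.
Qed.

Lemma maxr_dist_le (a b a' b' e : R) : `|a - a'| <= e -> `|b - b'| <= e ->
  `|Num.max a b - Num.max a' b'| <= e.
Proof.
rewrite !ler_norml => /andP[h1 h2] /andP[h3 h4].
have [l|l] := lerP a b; have [l'|l'] := lerP a' b'; apply/andP; split; lra.
Qed.

(** Both sides, multiplied by [r!], are within [eps / 2 * n ^ r] of [limit_density r c * n ^ r]. *)
Theorem turan_tight_linear_forests (r : nat) (c eps : R) : (3 <= r)%N -> 0 < c ->
  (r = 3%N -> c < 1) -> ((4 <= r)%N -> c < 1 / 2) -> 0 < eps ->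
  exists n0, forall n, (n0 <= n)%N ->
  `|(turan_number r n (tight_linear_forests r n (Num.truncn (c * n%:R))))%:R -
    Num.max ('C(Num.truncn (c * n%:R), r))%:R
       (('C(n, r))%:R - ('C(n - Num.truncn (c * n%:R / r%:R), r))%:R)| <=
  eps * n%:R ^+ r.
Proof.
move=> r3 c0 hc3 hc4 eps0.
have c1 : c < 1.
  case: (eqVneq r 3%N) => [/hc3//|rn3]; apply: lt_trans (hc4 _) _; last by lra.
  by rewrite ltn_neqAle eq_sym rn3.
have r0 : 0 < r%:R :> R by rewrite ltr0n; apply: leq_trans r3.
have r1 : 1 <= r%:R :> R by rewrite ler1n; apply: leq_trans r3.
have cr1 : c / r%:R <= 1 by rewrite ler_pdivrMr //; lra.
have cr0 : 0 < c / r%:R by rewrite divr_gt0.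
have e4 : 0 < eps / 4 by lra.
have gac : 0 <= c <= 1 by apply/andP; split; lra.
have gacr : 0 <= 1 - c / r%:R <= 1 by apply/andP; split; lra.
have ga1 : 0 <= (1 : R) <= 1 by apply/andP; split; lra.
(* The constant 2 absorbs the rounding and the shift by 1 in the constructions. A bound involves at
   most two binomials, whence [eps / 4]. *)
have [n1 H1] := bin_asymptotic r 2 gac e4.
have [n2 H2] := bin_asymptotic r 2 gacr e4.
have [n3 H3] := bin_asymptotic r 2 ga1 e4.
have e2 : 0 < eps / 2 by lra.
have [n4 H4] := turan_upper r3 c0 hc3 hc4 e2.
have [n5 H5] := large_nat 1 cr0.
exists (maxn n1 (maxn n2 (maxn n3 (maxn n4 n5)))) => n.
rewrite !geq_max => /and5P[/H1{}H1 /H2{}H2 /H3{}H3 /H4{}H4 /H5{}H5].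
set k := Num.truncn (c * n%:R) in H4 *; set s := Num.truncn (c * n%:R / r%:R).
set tn := turan_number _ _ _ in H4 *.
have nR : 0 <= n%:R :> R by [].
have cn0 : 0 <= c * n%:R by rewrite mulr_ge0 // ltW.
have crn0 : 0 <= c * n%:R / r%:R by rewrite divr_ge0 // ltW.
have crE : c * n%:R / r%:R = c / r%:R * n%:R by rewrite mulrAC.
have hk := trunc_close cn0; have hs := trunc_close crn0.
rewrite -/k in hk; rewrite -/s crE in hs.
have s_gt0 : (0 < s)%N by rewrite truncn_gt0 crE.
(* Rounding both quantities down is compatible with the requirement of the cover construction. *)
have rsk : (r * s <= k)%N.
  rewrite /k truncn_ge_nat // natrM -ler_pdivlMl // mulrC.
  by rewrite truncn_le.
have k_gt0 : (0 < k)%N by apply: leq_trans rsk; rewrite muln_gt0 s_gt0 andbT; apply: leq_trans r3.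
have kn : (k <= n)%N.
  rewrite -(ler_nat R); apply: le_trans (_ : c * n%:R <= _); first by rewrite truncn_le.
  by rewrite -[leRHS]mul1r ler_wpM2r // ltW.
have r_gt0 : (0 < r)%N by apply: leq_trans r3.
have sn : (s <= n)%N by apply: leq_trans kn; apply: leq_trans rsk; apply: leq_pmull.
have low1 := turan_clique_lower r_gt0 k_gt0 kn; rewrite -/tn in low1.
have low2 := turan_cover_lower r_gt0 s_gt0 sn rsk; rewrite -/tn in low2.
have F0 : 0 < r`!%:R :> R by rewrite ltr0n fact_gt0.
have F1 : 1 <= r`!%:R :> R by rewrite ler1n fact_gt0.
have pred_le m : (0 < m)%N -> m.-1%:R = m%:R - 1 :> R.
  by case: m => // m _; rewrite -[in RHS]natr1 /=; ring.
have sn' : (s.-1 <= n)%N by apply: leq_trans (leq_pred s) sn.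
have shift (x : R) : `|x| <= 1 -> `|x| <= 2 /\ `|x - 1| <= 2.
  by clear; rewrite !ler_norml => /andP[h1 h2]; split; apply/andP; split; lra.
have [ck ck'] := shift _ hk.
have cs : `|(n - s)%:R - (1 - c / r%:R) * n%:R| <= 2.
  have [+ _] := shift _ hs; rewrite natrB // -normrN; congr (`|_| <= _); ring.
have Bk := H1 k kn ck.
have Bk' : `|(r`! * 'C(k.-1, r))%:R - c ^+ r * n%:R ^+ r| <= eps / 4 * n%:R ^+ r.
  by apply: H1; [exact: leq_trans (leq_pred k) kn | rewrite pred_le // addrAC].
have Bs := H2 (n - s)%N (leq_subr _ _) cs.
have Bs' : `|(r`! * 'C(n - s.-1, r))%:R - (1 - c / r%:R) ^+ r * n%:R ^+ r| <=
    eps / 4 * n%:R ^+ r.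
  apply: H2; first exact: leq_subr.
  have [_] := shift _ hs.
  rewrite -normrN natrB // pred_le //; congr (`|_| <= _); ring.
have Bn := H3 n (leqnn n); rewrite mul1r subrr normr0 in Bn.
have {}Bn := Bn (ler0n _ 2).
rewrite expr1n in Bn.
set X := n%:R ^+ r in H4 Bk Bk' Bs Bs' Bn *.
have X0 : 0 <= X by apply: exprn_ge0.
have muE : limit_density r c * X = Num.max (c ^+ r * X) (1 * X - (1 - c / r%:R) ^+ r * X).
  by rewrite /limit_density mulrC maxr_pMr // ![X * _]mulrC mulrBl.
have upX : (r`! * tn)%:R <= limit_density r c * X + eps / 2 * X by rewrite -mulrDl.
have rhsX : `|r`!%:R * Num.max ('C(k, r))%:R (('C(n, r))%:R - ('C(n - s, r))%:R) -
    limit_density r c * X| <= eps / 2 * X.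
  rewrite muE maxr_pMr ?ler0n // mulrBr -!natrM; apply: maxr_dist_le.
    by apply: le_trans Bk _; clear -eps0 X0; rewrite ler_wpM2r //; lra.
  move: Bn Bs; rewrite !ler_norml => /andP[l1 l2] /andP[l3 l4].
  by clear -l1 l2 l3 l4 X0; apply/andP; split; lra.
have lowX : limit_density r c * X - eps / 2 * X <= (r`! * tn)%:R.
  rewrite muE lerBlDr ge_max; apply/andP; split.
    have : (r`! * 'C(k.-1, r))%:R <= (r`! * tn)%:R :> R.
      by rewrite ler_nat leq_mul2l low1 orbT.
    by move: Bk'; rewrite ler_norml => /andP[l1 l2] l3; clear -l1 l2 l3; lra.
  have : (r`! * 'C(n, r))%:R <= (r`! * tn)%:R + (r`! * 'C(n - s.-1, r))%:R :> R.
    by rewrite -natrD ler_nat -mulnDr leq_mul2l; move: low2; rewrite leq_subLR addnC => ->; rewrite orbT.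
  move: Bn Bs'; rewrite !ler_norml => /andP[l1 l2] /andP[l3 l4] l5.
  by clear -l1 l2 l3 l4 l5; lra.
set Y := Num.max _ _ in rhsX *.
have key : r`!%:R * `|tn%:R - Y| <= eps * X.
  rewrite -{1}[r`!%:R]ger0_norm ?ler0n // -normrM mulrBr -natrM.
  move: rhsX; rewrite !ler_norml => /andP[l1 l2].
  by clear -l1 l2 upX lowX; apply/andP; split; lra.
apply: le_trans key; rewrite -{1}[`|_|]mul1r ler_wpM2r //.
Qed.

End Asymptotics.


(* Translation into little-o notation *)
From mathcomp Require Import all_classical all_reals all_analysis.

Import numFieldNormedType.Exports.

Local Open Scope ring_scope.
Local Open Scope classical_set_scope.

Theorem theorem1p2 (R : realType) (r : nat) (c : R)
    (hr : (3 <= r)%N) (hc0 : 0 < c)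
    (hc3 : r = 3%N -> c < 1) (hc4 : (4 <= r)%N -> c < 1 / 2) :
  (fun n : nat =>
     (turan_number r n
        (tight_linear_forests r n (Num.truncn (c * n%:R))))%:R : R) =
  (fun n : nat =>
     Num.max ('C(Num.truncn (c * n%:R), r))%:R
             (('C(n, r))%:R - ('C(n - Num.truncn (c * n%:R / r%:R), r))%:R) : R)
  +o_\oo (fun n : nat => n%:R ^+ r : R).
Proof.
apply/eqaddoP => eps eps0.
have [n0 Hn0] := turan_tight_linear_forests hr hc0 hc3 hc4 eps0.
exists n0 => //= n /Hn0 le_eps; apply: le_trans le_eps _.
by rewrite [X in _ <= _ * X]ger0_norm ?exprn_ge0.
Qed.
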